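(* Every infinite-dimensional separable real Banach space admits an equivalent norm $|\cdot|$ which is average locally uniformly rotund (ALUR) (and hence rotund) and G\^ateaux smooth, but which is not locally uniformly rotund (LUR).
   Context: For a Banach space $(X,\|\cdot\|)$, $B_X$ and $S_X$ denote the closed unit ball and the unit sphere. A slice of a set $K\subset X$ is a set $S(K,x^*,\alpha)=\{y\in K: x^*(y)>\sup x^*(K)-\alpha\}$ with $\alpha>0$ and $x^*\in X^*\setminus\{0\}$ bounded above on $K$. A point $x\in S_X$ is a denting point of $B_X$ if for each norm neighbourhood $V$ of $x$ there is a slice $S$ of $B_X$ with $x\in S\subset V$. The norm is average locally uniformly rotund (ALUR) if every point of $S_X$ is a denting point of $B_X$. The norm is rotund if every point of $S_X$ is an extreme point of $B_X$. A point $x\in S_X$ is a LUR point of $B_X$ if $x_n\to x$ in norm whenever $(x_n)_n\subset X$ satisfies $\lim_n (2\|x\|^2+2\|x_n\|^2-\|x+x_n\|^2)=0$; the norm is locally uniformly rotund (LUR) if every point of $S_X$ is a LUR point. The norm is G\^ateaux smooth if for all $x,y\in S_X$, $\lim_{h\to0}\frac{\|x+hy\|+\|x-hy\|-2}{h}=0$. *)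

(* Defs.v *)
From HB Require Import structures.
From mathcomp Require Import all_boot all_order all_algebra.
From mathcomp Require Import all_classical all_reals all_analysis.

Set Implicit Arguments.
Unset Strict Implicit.
Unset Printing Implicit Defensive.

Import Order.TTheory GRing.Theory Num.Theory.
Import numFieldNormedType.Exports.

Local Open Scope classical_set_scope.
Local Open Scope ring_scope.

Definition separable_space (T : topologicalType) : Prop :=
  exists D : set T, countable D /\ dense D.

Definition finite_dimensional (R : realType) (X : lmodType R) : Prop :=
  exists (n : nat) (e : 'I_n -> X),
    forall x : X, exists c : 'I_n -> R, x = \sum_(i < n) c i *: e i.

Definition infinite_dimensional (R : realType) (X : lmodType R) : Prop :=
  ~ finite_dimensional X.

Definition unit_ball (R : realType) (X : normedModType R) : set X :=
  [set x | `|x| <= 1].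

Definition unit_sphere (R : realType) (X : normedModType R) : set X :=
  [set x | `|x| = 1].

Arguments unit_ball {R} X _.
Arguments unit_sphere {R} X _.

Definition slice (R : realType) (X : normedModType R)
    (K : set X) (f : {linear X -> R^o}) (a : R) : set X :=
  [set y | K y /\ sup (f @` K) - a < f y].

Definition is_slice (R : realType) (X : normedModType R) (K S : set X) : Prop :=
  exists (f : {linear X -> R^o}) (a : R),
    [/\ continuous f, exists y, f y != 0, has_ubound (f @` K), 0 < a
      & S = slice K f a].

Definition denting_point (R : realType) (X : normedModType R) (x : X) : Prop :=
  unit_sphere X x /\
  forall V : set X, nbhs x V ->
    exists S : set X, [/\ is_slice (unit_ball X) S, S x & S `<=` V].

Definition ALUR (R : realType) (X : normedModType R) : Prop :=
  forall x : X, unit_sphere X x -> denting_point x.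

Definition extreme_point (R : realType) (X : lmodType R)
    (K : set X) (x : X) : Prop :=
  K x /\
  forall (y z : X) (t : R), K y -> K z -> 0 < t < 1 ->
    x = t *: y + (1 - t) *: z -> y = x /\ z = x.

Definition rotund (R : realType) (X : normedModType R) : Prop :=
  forall x : X, unit_sphere X x -> extreme_point (unit_ball X) x.

Definition LUR_point (R : realType) (X : normedModType R) (x : X) : Prop :=
  unit_sphere X x /\
  forall u : nat -> X,
    (2 * `|x| ^+ 2 + 2 * `|u n| ^+ 2 - `|x + u n| ^+ 2) @[n --> \oo] --> (0 : R) ->
    u n @[n --> \oo] --> x.

Definition LUR (R : realType) (X : normedModType R) : Prop :=
  forall x : X, unit_sphere X x -> LUR_point x.

Definition gateaux_smooth (R : realType) (X : normedModType R) : Prop :=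
  forall x y : X, unit_sphere X x -> unit_sphere X y ->
    ((`|x + h *: y| + `|x - h *: y| - 2) / h) @[h --> (0 : R)^'] --> (0 : R).

Record equiv_norm (R : realType) (X : normedModType R) := EquivNorm {
  enorm :> X -> R ;
  enormD : forall x y, enorm (x + y) <= enorm x + enorm y ;
  enormZ : forall (l : R) x, enorm (l *: x) = `|l| * enorm x ;
  enorm_eq0 : forall x, enorm x = 0 -> x = 0 ;
  enorm_equiv : exists m M : R,
    [/\ 0 < m, 0 < M & forall x, m * `|x| <= enorm x <= M * `|x|]
}.

(* [renormed N] is the vector space X with the norm N: it inherits only the
   linear structure of X, and its topology is the one induced by N. *)
Definition renormed (R : realType) (X : normedModType R) (N : equiv_norm X)
  : Type := X.

HB.instance Definition _ (R : realType) (X : normedModType R)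
  (N : equiv_norm X) := GRing.Lmodule.on (renormed N).

HB.instance Definition _ (R : realType) (X : normedModType R)
  (N : equiv_norm X) :=
  Lmodule_isNormed.Build R (renormed N) (@enormD _ _ N) (@enormZ _ _ N)
    (@enorm_eq0 _ _ N).

Lemma renormedE (R : realType) (X : normedModType R) (N : equiv_norm X)
  (x : renormed N) : `|x| = N x.
Proof. by []. Qed.

(* Main.v *)
(** The norm is the gauge [N] of [{Phi <= 1}], where
      [Phi x = h (f0 x) + \sum_k 2^-(k+1) (G_k x + h (c_k x))].
    Here [h] is the Huber function, which is C^1, convex, quadratic near [0] and
    affine far from [0]; [f0] is a functional with [f0 e_0 = 1]; the [c_k] are
    functionals vanishing at [e_0] which, up to a scalar, are norming modulo [e_0];
    and [G_k] is the distance to [span(e_0, ..., e_k)] in an auxiliary equivalent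
    norm [p], smoothed by an inf-convolution with a quadratic cost on the
    coefficients along the later vectors of a sequence [(e_i)] with dense span.

    Smoothness: the cost makes the second difference of [G_k] quadratically small
    in the dense set of directions spanned by the [e_i].

    Denting: at [x] with [Phi x = 1], take the sum of subgradients of the pieces of
    [Phi], but with the one of [G_k] scaled by [1 - theta].  On a thin slice of this
    functional the Bregman terms of [h \o c_j] force [c_j y] near [c_j x], and
    [theta (G_k y - G_k x)] must be small; when [x] is near [span(e_0, ..., e_k)] so
    is [y], and the norming functionals then give [y] near [x] modulo [e_0].

    Failure of LUR: [p] is such that a sequence [y_n] has norm [1] and distance [1]
    to [span(e_0, ..., e_n)], while [c_j y_n = 0] for [j < n].  Thus [Phi] is
    asymptotically affine on the segments joining [(5/4) e_0] to [e_0 + y_n / 4],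
    because [h] is affine between [1] and [5/4]. *)

Require Import Defs.
From HB Require Import structures.
From mathcomp Require Import all_boot all_order all_algebra.
From mathcomp Require Import all_classical all_reals all_analysis.
From mathcomp Require Import ring lra.
Import Order.TTheory GRing.Theory Num.Theory.
Import numFieldNormedType.Exports.
Local Open Scope classical_set_scope.
Local Open Scope ring_scope.

Set Implicit Arguments.
Unset Strict Implicit.
Unset Printing Implicit Defensive.

(** * Hahn-Banach theorem and subgradients *)

Section IndexedInf.
Variables (R : realType) (I : Type).
Implicit Types (A : set I) (f : I -> R).

Definition infr A f : R := inf (f @` A).

Lemma infr_le A f c i : (forall j, A j -> c <= f j) -> A i -> infr A f <= f i.
Proof.
move=> h Ai; apply: ge_inf; last by exists i.
by exists c => _ [j Aj <-]; exact: h.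
Qed.

Lemma le_infr A f c i : A i -> (forall j, A j -> c <= f j) -> c <= infr A f.
Proof.
move=> Ai h; apply: lb_le_inf; first by exists (f i), i.
by move=> _ [j Aj <-]; exact: h.
Qed.

Lemma infr_lt A f c i : A i -> infr A f < c -> exists2 j, A j & f j < c.
Proof.
move=> Ai h; apply: contrapT => /forall2NP hn.
suff : c <= infr A f by rewrite leNgt h.
apply: (le_infr Ai) => j Aj; have [|/negP] := hn j; first by [].
by rewrite -leNgt.
Qed.

End IndexedInf.

Section HahnBanach.
Variables (R : realType) (X : lmodType R).
Implicit Types (p q f : X -> R).

Definition is_lin f := forall a x y, f (a *: x + y) = a * f x + f y.

Lemma is_lin0 f : is_lin f -> f 0 = 0.
Proof. by move=> h; have := h 1 0 0; rewrite scale1r addr0; lra. Qed.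

Lemma is_linD f x y : is_lin f -> f (x + y) = f x + f y.
Proof. by move=> h; have := h 1 x y; rewrite scale1r mul1r. Qed.

Lemma is_linZ f a x : is_lin f -> f (a *: x) = a * f x.
Proof. by move=> h; have := h a x 0; rewrite !addr0 is_lin0// addr0. Qed.

Lemma is_linN f x : is_lin f -> f (- x) = - f x.
Proof. by move=> h; rewrite -scaleN1r is_linZ// mulN1r. Qed.

Lemma is_linB f x y : is_lin f -> f (x - y) = f x - f y.
Proof. by move=> h; rewrite is_linD// is_linN. Qed.

Definition sublinear p :=
  (forall x y, p (x + y) <= p x + p y) /\
  (forall t x, 0 <= t -> p (t *: x) = t * p x).

Lemma sublinear0 p : sublinear p -> p 0 = 0.
Proof. by case=> _ h; rewrite -(scale0r (0 : X)) h// mul0r. Qed.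

Lemma sublinear_geN p x : sublinear p -> - p (- x) <= p x.
Proof. by move=> h; have := h.1 x (- x); rewrite subrr sublinear0//; lra. Qed.

(** The shift along the ray of [y] forces [slide p y (- y) <= - p y], so a linear minorant of
    [slide p y] attains [p] at [y]. *)
Definition slide p y x := infr [set t | 0 <= t] (fun t => p (x + t *: y) - t * p y).

Section Slide.
Variables (p : X -> R) (sp : sublinear p) (y : X).

Let slide_lb x (t : R) : 0 <= t -> - p (- x) <= p (x + t *: y) - t * p y.
Proof.
move=> t0; have := sp.1 (x + t *: y) (- x).
by rewrite addrAC subrr add0r sp.2//; lra.
Qed.

Lemma slide_le x (t : R) : 0 <= t -> slide p y x <= p (x + t *: y) - t * p y.
Proof. by move=> t0; exact: (infr_le (c := - p (- x)) (slide_lb x)). Qed.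

Let slide_ge x (c : R) : (forall t : R, 0 <= t -> c <= p (x + t *: y) - t * p y) ->
  c <= slide p y x.
Proof. by move=> h; exact: (@le_infr _ _ _ _ _ 0 _ h). Qed.

Lemma slide_lep x : slide p y x <= p x.
Proof. by have := @slide_le x 0 (lexx _); rewrite scale0r addr0 mul0r subr0. Qed.

Lemma sublinear_slide : sublinear (slide p y).
Proof.
have ZZ (t : R) x : 0 < t -> slide p y (t *: x) <= t * slide p y x.
  move=> t0; rewrite -ler_pdivrMl//; apply: slide_ge => s s0.
  rewrite ler_pdivrMl//; apply: (le_trans (slide_le _ (mulr_ge0 (ltW t0) s0))).
  by rewrite -scalerA -scalerDr (sp.2 _ _ (ltW t0)) mulrBr mulrA.
split=> [x z|t x].
  rewrite -lerBlDr; apply: slide_ge => t t0; rewrite lerBlDr -lerBlDl.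
  apply: slide_ge => s s0; rewrite lerBlDl.
  apply: (le_trans (slide_le _ (addr_ge0 t0 s0))).
  have := sp.1 (x + t *: y) (z + s *: y).
  by rewrite addrACA -scalerDl; lra.
rewrite le_eqVlt => /predU1P[<-|t0].
  rewrite scale0r mul0r; apply/le_anti/andP; split.
    by rewrite -(sublinear0 sp); exact: slide_lep.
  by apply: slide_ge => s s0; rewrite add0r sp.2// subrr.
apply/le_anti/andP; split; first exact: ZZ.
rewrite -ler_pdivlMl// -{1}[x](@scalerK _ _ t) ?gt_eqF//.
by apply: ZZ; rewrite invr_gt0.
Qed.

End Slide.

(* A minimal sublinear functional is linear: it equals all of its slides. *)
Lemma sublinear_minorant p : sublinear p ->
  exists f, is_lin f /\ forall x, f x <= p x.
Proof.
move=> sp.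
pose T := {q : X -> R | sublinear q /\ forall x, q x <= p x}.
(* The order is reversed: a maximal element is a pointwise minimal sublinear functional. *)
pose le_ (a b : T) := `[< forall x, sval b x <= sval a x >].
have tlb (a : T) x : - p (- x) <= sval a x.
  case: a => q [sq qp] /=; apply: le_trans (sublinear_geN x sq).
  by rewrite lerN2.
have [||||m minm] := @Zorn T le_.
- by move=> t; apply/asboolP.
- move=> r s t /asboolP h1 /asboolP h2; apply/asboolP => x.
  exact: le_trans (h2 x) (h1 x).
- move=> [s Hs] [t Ht] /asboolP /= h1 /asboolP /= h2; apply: eq_exist.
  by apply/funext => x; apply/le_anti; rewrite h1 h2.
- move=> A totA; have [[a0 Aa0]|nA] := pselect (exists a, A a); last first.
    exists (exist _ p (conj sp (fun x => lexx (p x)))) => s As.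
    by exfalso; apply: nA; exists s.
  pose q x := infr A (fun a => sval a x).
  have q_le a x : A a -> q x <= sval a x.
    by move=> Aa; apply: infr_le (fun j _ => tlb j x) Aa.
  have q_ge x c : (forall a, A a -> c <= sval a x) -> c <= q x.
    by move=> h; exact: le_infr Aa0 h.
  have sq : sublinear q.
    split=> [x y|t x t0].
      rewrite -lerBlDr; apply: (q_ge) => a Aa; rewrite lerBlDr -lerBlDl.
      apply: (q_ge) => b Ab; rewrite lerBlDl.
      (* Subadditivity of the infimum uses totality of the chain: the smaller of [a] and [b] serves
         at both points. *)
      have [c [Ac ca cb]] : exists c, [/\ A c, forall x, sval c x <= sval a x
          & forall x, sval c x <= sval b x].
        by have [/asboolP h|/asboolP h] := totA _ _ Aa Ab; [exists b|exists a].
      apply: (le_trans (q_le _ _ Ac)); apply: (le_trans ((svalP c).1.1 _ _)).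
      by rewrite lerD.
    apply/le_anti/andP; split.
      move: t0; rewrite [0 <= t]le_eqVlt => /predU1P[<-|t0].
        rewrite mul0r scale0r; apply: (le_trans (q_le _ _ Aa0)).
        by rewrite (sublinear0 (svalP a0).1).
      rewrite -ler_pdivrMl//; apply: (q_ge) => a Aa; rewrite ler_pdivrMl//.
      by rewrite -((svalP a).1.2 _ _ (ltW t0)); exact: q_le.
    apply: (q_ge) => a Aa; rewrite ((svalP a).1.2 _ _ t0).
    by rewrite ler_wpM2l// q_le.
  have qp x : q x <= p x by apply: (le_trans (q_le _ x Aa0)); exact: (svalP a0).2.
  exists (exist _ q (conj sq qp)) => s As; apply/asboolP => x /=.
  exact: q_le.
case: m minm => q [sq qp] /= minm; exists q; split=> // a x y.
have slideE y' x' : slide q y' x' = q x'.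
  have sl : sublinear (slide q y') /\ forall x, slide q y' x <= p x.
    split; first exact: sublinear_slide.
    by move=> z; apply: le_trans (qp z); exact: slide_lep.
  have qq : le_ (exist _ q (conj sq qp)) (exist _ _ sl).
    by apply/asboolP => z /=; exact: slide_lep.
  exact: (congr1 (fun t : T => sval t x') (minm _ qq)).
(* The slide along [v] equals [q]; its parameter [1] gives [q u <= q (u + v) - q v]. *)
have qD u v : q (u + v) = q u + q v.
  apply/le_anti/andP; split; first exact: sq.1.
  by have := slide_le sq v u ler01; rewrite slideE scale1r mul1r; lra.
have qN u : q (- u) = - q u.
  by have := qD u (- u); rewrite subrr sublinear0//; lra.
rewrite qD; congr (_ + _); have [a0|a0] := leP 0 a; first exact: sq.2.
rewrite -[a]opprK scaleNr qN sq.2 ?mulNr//; lra.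
Qed.

Lemma hahn_banach p y : sublinear p ->
  exists f, [/\ is_lin f, forall x, f x <= p x & f y = p y].
Proof.
move=> sp; have [f [lf fp]] := sublinear_minorant (sublinear_slide sp y).
have fp' x : f x <= p x by apply: (le_trans (fp x)); exact: slide_lep.
exists f; split=> //; apply/le_anti/andP; split=> //.
have := fp (- y); have := slide_le sp y (- y) ler01.
by rewrite scale1r addNr sublinear0// mul1r (is_linN y lf); lra.
Qed.

Definition cvx (phi : X -> R) := forall x y t, 0 <= t <= 1 ->
  phi (t *: x + (1 - t) *: y) <= t * phi x + (1 - t) * phi y.

Lemma cvx_comb phi a b x y : cvx phi -> 0 <= a -> 0 <= b -> 0 < a + b ->
  (a + b) * phi ((a + b)^-1 *: (a *: x + b *: y)) <= a * phi x + b * phi y.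
Proof.
move=> cphi a0 b0 ab0.
have ab' : a + b != 0 by rewrite gt_eqF.
have t01 : 0 <= a / (a + b) <= 1.
  by rewrite divr_ge0 ?(ltW ab0)//= ler_pdivrMr// mul1r lerDl.
have e1 : 1 - a / (a + b) = b / (a + b) by field.
have := cphi x y _ t01; rewrite e1 => h.
rewrite -ler_pdivlMl// scalerDr !scalerA ![(a + b)^-1 * _]mulrC.
by apply: (le_trans h); rewrite le_eqVlt; apply/orP; left; apply/eqP; field.
Qed.

(** The infimum [D v] of the difference quotients is the one-sided directional derivative. Convexity
    makes it finite and sublinear, and any linear minorant of it is a subgradient. *)
Lemma subgradient phi x : cvx phi ->
  exists f, is_lin f /\ forall v, f v <= phi (x + v) - phi x.
Proof.
move=> cphi.
pose D v := infr [set h | 0 < h] (fun h => (phi (x + h *: v) - phi x) / h).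
have lb v h : 0 < h -> - (phi (x - v) - phi x) <= (phi (x + h *: v) - phi x) / h.
  move=> h0; rewrite ler_pdivlMr//.
  have := @cvx_comb phi 1 h (x + h *: v) (x - v) cphi ler01 (ltW h0) _.
  rewrite scale1r scalerBr addrACA subrr addr0.
  have -> : x + h *: x = (1 + h) *: x by rewrite scalerDl scale1r.
  by rewrite scalerK ?gt_eqF//; nra.
have D_le v h : 0 < h -> D v <= (phi (x + h *: v) - phi x) / h.
  by move=> h0; exact: (infr_le (lb v)).
have D_ge v c : (forall h, 0 < h -> c <= (phi (x + h *: v) - phi x) / h) -> c <= D v.
  by move=> H; exact: (@le_infr _ _ _ _ _ 1 ltr01 H).
have DZ t v : 0 < t -> D (t *: v) <= t * D v.
  move=> t0; rewrite -ler_pdivrMl//; apply: (D_ge) => h h0.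
  rewrite ler_pdivrMl//; have := @D_le (t *: v) (h / t) (divr_gt0 h0 t0).
  rewrite scalerA divfK ?gt_eqF// => /le_trans; apply.
  by rewrite le_eqVlt; apply/orP; left; apply/eqP; field; rewrite !gt_eqF.
have sD : sublinear D.
  split=> [u v|t v].
    rewrite -lerBlDr; apply: (D_ge) => h h0; rewrite lerBlDr -lerBlDl.
    apply: (D_ge) => k k0; rewrite lerBlDl.
    have hk0 : 0 < h + k by exact: addr_gt0.
    (* The step [h * k / (h + k)] along [u + v] lands on the convex combination of [x + h *: u] and
       [x + k *: v] with weights proportional to [k] and [h]. *)
    have r0 : 0 < h * k / (h + k) by rewrite divr_gt0 ?mulr_gt0.
    apply: (le_trans (D_le _ _ r0)).
    have := @cvx_comb phi h k (x + k *: v) (x + h *: u) cphi (ltW h0) (ltW k0) hk0.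
    have -> : h *: (x + k *: v) + k *: (x + h *: u) =
              (h + k) *: x + (h * k) *: (u + v).
      rewrite !scalerDr !scalerA [k * h]mulrC addrACA -scalerDl.
      by rewrite [_ *: v + _]addrC.
    rewrite scalerDr scalerA mulVf ?gt_eqF// scale1r scalerA [_^-1 * _]mulrC => H.
    rewrite ler_pdivrMr//.
    have -> : ((phi (x + h *: u) - phi x) / h + (phi (x + k *: v) - phi x) / k)
       * (h * k / (h + k)) = (h * phi (x + k *: v) + k * phi (x + h *: u)) / (h + k)
        - phi x by field; rewrite !gt_eqF.
    by rewrite lerD2r ler_pdivlMr// mulrC.
  rewrite le_eqVlt => /predU1P[<-|t0].
    rewrite scale0r mul0r; apply/le_anti/andP; split.
      by apply: (le_trans (@D_le 0 1 ltr01)); rewrite scaler0 addr0 subrr mul0r.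
    by apply: (D_ge) => h h0; rewrite scaler0 addr0 subrr mul0r.
  apply/le_anti/andP; split; first exact: DZ.
  rewrite -ler_pdivlMl// -{1}[v](@scalerK _ _ t) ?gt_eqF//.
  by apply: (DZ); rewrite invr_gt0.
have [f [lf fD]] := sublinear_minorant sD.
exists f; split=> // v; apply: (le_trans (fD v)).
by have := D_le v 1 ltr01; rewrite scale1r divr1.
Qed.

End HahnBanach.

(** * Weighted series and the Huber function *)

Section GeometricWeights.
Variable R : realType.
Implicit Types (u v : nat -> R) (K c : R).

(* Meant for bounded [u]; the weights [2^-(i+1)] have total mass [1]. *)
Definition wsum u : R := limn (series (fun i => u i / 2 ^+ i.+1)).

Definition ubnd K u := forall i, `|u i| <= K.

Lemma weights_sum n : \sum_(0 <= i < n) ((2 : R) ^+ i.+1)^-1 = 1 - (2 ^+ n)^-1.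
Proof.
elim: n => [|n IH]; first by rewrite big_geq// expr0 invr1 subrr.
rewrite big_nat_recr//= IH exprS invfM; set a := (2 ^+ n)^-1; lra.
Qed.

Lemma weights_tail n N :
  \sum_(0 <= i < N) (n <= i)%:R / 2 ^+ i.+1 <= ((2 : R) ^+ n)^-1.
Proof.
have [Nn|nN] := leqP N n.
  rewrite big_nat big1 ?invr_ge0 ?exprn_ge0// => i /andP[_ iN].
  by rewrite leqNgt (leq_trans iN Nn)/= mul0r.
rewrite (@big_cat_nat _ _ _ n)//= ?(ltnW nN)//.
rewrite [X in X + _]big_nat big1 ?add0r; last first.
  by move=> i /andP[_ iN]; rewrite leqNgt iN/= mul0r.
have := weights_sum N; rewrite (@big_cat_nat _ _ _ n)//= ?(ltnW nN)// weights_sum.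
under [X in _ -> X <= _]eq_big_nat => i /andP[ni _] do rewrite ni mul1r.
have : (0 : R) < (2 ^+ N)^-1 by rewrite invr_gt0 exprn_gt0.
by move=> ? ?; lra.
Qed.

Lemma w_gt0 i : 0 < ((2 : R) ^+ i)^-1.
Proof. by rewrite invr_gt0 exprn_gt0. Qed.

Lemma cvg_wcst c : series (fun i => c / 2 ^+ i.+1) @ \oo --> c.
Proof.
have := @cvg_geometric_series_half R c 0; rewrite expr0 divr1.
suff -> : (fun k => (c / (2 ^ (k + 1))%:R : R^o)) = (fun i => c / 2 ^+ i.+1) by [].
by apply/funext => k; rewrite addn1 natrX.
Qed.

Lemma wsum_cvg K u : ubnd K u -> cvgn (series (fun i => u i / 2 ^+ i.+1)).
Proof.
move=> uK; apply: normed_cvg.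
apply: (@series_le_cvg _ _ (fun i => K / 2 ^+ i.+1)) => [n|n|n|].
- exact: normr_ge0.
- by rewrite divr_ge0 ?exprn_ge0// (le_trans _ (uK 0%N)).
- by rewrite /= normrM (ger0_norm (ltW (w_gt0 _))) ler_pM2r ?w_gt0.
- by apply/cvg_ex; exists K; exact: cvg_wcst.
Qed.

Lemma wsum_cst c : wsum (fun=> c) = c.
Proof. by apply: cvg_lim => //; exact: cvg_wcst. Qed.

Lemma wsumD K L u v : ubnd K u -> ubnd L v ->
  wsum (fun i => u i + v i) = wsum u + wsum v.
Proof.
move=> hu hv; rewrite /wsum -limD; try exact: wsum_cvg hu; try exact: wsum_cvg hv.
congr (limn _); apply/funext => n; rewrite addrfctE /series/= -big_split/=.
by apply: eq_bigr => i _; rewrite mulrDl.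
Qed.

Lemma wsumZ K u c : ubnd K u -> wsum (fun i => c * u i) = c * wsum u.
Proof.
move=> hu; apply: cvg_lim => //.
suff -> : series (fun i => c * u i / 2 ^+ i.+1) =
          (fun n => c * series (fun i => u i / 2 ^+ i.+1) n).
  by apply: cvgM; [exact: cvg_cst|exact: wsum_cvg hu].
apply/funext => n; rewrite /series/= mulr_sumr.
by apply: eq_bigr => i _; rewrite -mulrA.
Qed.

Lemma ubndD u v K L : ubnd K u -> ubnd L v ->
  ubnd (K + L) (fun i => u i + v i).
Proof. by move=> hu hv i; apply: (le_trans (ler_normD _ _)); exact: lerD. Qed.

Lemma ubndZ u K c : ubnd K u -> ubnd (`|c| * K) (fun i => c * u i).
Proof. by move=> hu i; rewrite normrM ler_wpM2l. Qed.

Lemma wsumB u v K L : ubnd K u -> ubnd L v ->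
  wsum (fun i => u i - v i) = wsum u - wsum v.
Proof.
move=> hu hv; rewrite -mulN1r -(wsumZ _ hv) -(wsumD hu (L := L)).
  by congr wsum; apply/funext => i; rewrite mulN1r.
by move=> i; rewrite mulN1r normrN.
Qed.

Lemma wsum_le K L u v : ubnd K u -> ubnd L v -> (forall i, u i <= v i) ->
  wsum u <= wsum v.
Proof.
move=> hu hv uv; apply: ler_lim; [exact: wsum_cvg hu|exact: wsum_cvg hv|].
near=> n; apply: ler_sum => i _; rewrite ler_pM2r ?w_gt0//.
Unshelve. all: by end_near. Qed.

Lemma ubnd_cst c : ubnd `|c| (fun=> c).
Proof. by move=> i. Qed.

Lemma wsum_norm K u : ubnd K u -> `|wsum u| <= K.
Proof.
move=> hu; rewrite ler_norml; apply/andP; split.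
  rewrite -[leLHS]wsum_cst; apply: (wsum_le (ubnd_cst _) hu) => i.
  by have := hu i; rewrite ler_norml => /andP[].
rewrite -[leRHS]wsum_cst; apply: (wsum_le hu (ubnd_cst _)) => i.
by have := hu i; rewrite ler_norml => /andP[].
Qed.

Lemma wsum_ge0 K u : ubnd K u -> (forall i, 0 <= u i) -> 0 <= wsum u.
Proof.
move=> hu h; rewrite -[leLHS]wsum_cst; exact: (wsum_le (ubnd_cst _) hu).
Qed.

Lemma wsum_term K u k : ubnd K u -> (forall i, 0 <= u i) ->
  u k / 2 ^+ k.+1 <= wsum u.
Proof.
move=> hu h; apply: limr_ge; first exact: wsum_cvg hu.
near=> n; rewrite /series/= (bigD1_seq k)/= ?iota_uniq//.
  by rewrite lerDl sumr_ge0// => i _; rewrite divr_ge0 ?exprn_ge0.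
rewrite mem_index_iota/=; near: n; exact: nbhs_infty_gt.
Unshelve. all: by end_near. Qed.

(** Terms below [n] carry total weight at most [1], and those from [n] on carry [2^-n]. *)
Lemma wsum_head K u n d : ubnd K u -> 0 <= d -> (forall i, (i < n)%N -> `|u i| <= d) ->
  `|wsum u| <= d + K / 2 ^+ n.
Proof.
move=> hu d0 h.
have K0 : 0 <= K by apply: le_trans (hu 0%N).
rewrite -lim_norm; last exact: wsum_cvg hu.
apply: limr_le; first by apply: is_cvg_norm; exact: wsum_cvg hu.
near=> N; apply: (le_trans (ler_norm_sum _ _ _)).
apply: (@le_trans _ _ (\sum_(0 <= i < N) (d / 2 ^+ i.+1 + K * ((n <= i)%:R / 2 ^+ i.+1)))).
  apply: ler_sum => i _; rewrite normrM (ger0_norm (ltW (w_gt0 _))) mulrA -mulrDl.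
  rewrite ler_pM2r ?w_gt0//; case: leqP => ni; rewrite ?mulr1 ?mulr0 ?addr0.
    by rewrite (le_trans (hu i))// lerDr.
  exact: h.
rewrite big_split/= -!mulr_sumr weights_sum lerD// ?ler_wpM2l ?weights_tail//.
by have := w_gt0 N; nra.
Unshelve. all: by end_near. Qed.

(** [n] and [d] depend only on [K] and [e], which reduces an estimate on uniformly bounded weighted
    sums to finitely many terms. *)
Lemma wsum_small K e : 0 < e -> exists n d, 0 < d /\ forall u, ubnd K u ->
  (forall i, (i < n)%N -> `|u i| <= d) -> `|wsum u| <= e.
Proof.
move=> e0; have [n hn] : exists n, K / 2 ^+ n <= e / 2.
  have [K0|K0] := leP K 0.
    by exists 0%N; rewrite expr0 divr1 (le_trans K0)// divr_ge0// ltW.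
  exists (Num.truncn (K / (e / 2))).+1; rewrite ler_pdivrMr ?exprn_gt0//.
  rewrite -ler_pdivrMl ?divr_gt0// mulrC.
  have /andP[_ /ltW /le_trans] := truncn_itv (ltW (divr_gt0 K0 (divr_gt0 e0 (ltr0n R 2)))).
  by apply; rewrite -natrX ler_nat ltnW// ltn_expl.
exists n, (e / 2); split=> [|u hu h]; first by rewrite divr_gt0.
by apply: (le_trans (wsum_head hu _ h)); lra.
Qed.

End GeometricWeights.

Section Huber.
Variable R : realType.
Implicit Types s t : R.

Definition huber t : R := if `|t| <= 2^-1 then t ^+ 2 else `|t| - 4^-1.
Definition dhuber t : R := if `|t| <= 2^-1 then 2 * t else Num.sg t.

Let cases t :
  [\/ [/\ - 2^-1 <= t, t <= 2^-1, huber t = t ^+ 2 & dhuber t = 2 * t],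
      [/\ 2^-1 < t, huber t = t - 4^-1 & dhuber t = 1] |
      [/\ t < - 2^-1, huber t = - t - 4^-1 & dhuber t = -1]].
Proof.
rewrite /huber /dhuber; have [|] := leP `|t| 2^-1.
  by rewrite ler_norml => /andP[? ?]; constructor 1.
rewrite ltr_normr => /orP[h|h].
  have t0 : 0 < t by lra.
  by constructor 2; rewrite gtr0_norm// gtr0_sg.
have t0 : t < 0 by lra.
by constructor 3; rewrite ltr0_norm// ltr0_sg//; split=> //; lra.
Qed.


Ltac huber_nra t s :=
  case: (cases t) => [[? ? -> ->]|[? -> ->]|[? -> ->]];
  case: (cases s) => [[? ? -> _]|[? -> _]|[? -> _]];
  have := sqr_ge0 (s - t); have := sqr_ge0 (s - 2^-1); have := sqr_ge0 (s + 2^-1);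
  have := sqr_ge0 (t - 2^-1); have := sqr_ge0 (t + 2^-1); rewrite !expr2 => ? ? ? ? ?; nra.

Lemma huber_ge s t : huber t + dhuber t * (s - t) <= huber s.
Proof. by huber_nra t s. Qed.

Lemma huber_le s t : huber s <= huber t + dhuber t * (s - t) + (s - t) ^+ 2.
Proof. by huber_nra t s. Qed.

Lemma dhuber_le1 t : `|dhuber t| <= 1.
Proof.
by case: (cases t) => [[? ? _ ->]|[_ _ ->]|[_ _ ->]]; rewrite ?normrN ?normr1// ler_norml; lra.
Qed.

Lemma huberN t : huber (- t) = huber t.
Proof. by rewrite /huber normrN sqrrN. Qed.

Lemma huber0 : huber 0 = 0.
Proof. by rewrite /huber normr0 expr0n/= invr_ge0 ler0n. Qed.

Lemma huber_ge0 t : 0 <= huber t.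
Proof. by case: (cases t) => [[? ? -> _]|[? -> _]|[? -> _]]; nra. Qed.

Lemma huber_gt t : `|t| - 4^-1 <= huber t.
Proof.
have : 0 <= (`|t| - 2^-1) ^+ 2 by exact: sqr_ge0.
by rewrite /huber; case: ifP => // _; rewrite -[t ^+ 2]real_normK ?num_real//; nra.
Qed.

Lemma huberE t : 2^-1 <= t -> huber t = t - 4^-1.
Proof. by case: (cases t) => [[? ? -> _]|[? -> _]|[? -> _]] ?; nra. Qed.

Lemma huber_sq t s : `|t| <= 2^-1 -> `|s| <= 2^-1 ->
  huber s - huber t - dhuber t * (s - t) = (s - t) ^+ 2.
Proof. by rewrite /huber /dhuber => -> ->; ring. Qed.

Lemma huber_lip s t : `|huber s - huber t| <= `|s - t|.
Proof.
have h (a b : R) : huber a - huber b <= `|a - b|.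
  have := huber_ge b a; have := dhuber_le1 a.
  have := ler_norm (dhuber a * (a - b)); rewrite normrM.
  by have := normr_ge0 (a - b); nra.
by rewrite ler_norml h lerBrDl; have := h t s; rewrite distrC; lra.
Qed.

(** For [t] nonzero the slope is nonzero and the linear term alone controls [s - t]; at [t = 0] the
    slope vanishes but [0] is a strict minimum. This makes up for the lack of curvature where
    [huber] is affine. *)
Lemma huber_exposed t d : 0 < d -> exists2 z, 0 < z & forall s,
  `|dhuber t * (s - t)| <= z -> huber s <= huber t + z -> `|s - t| <= d.
Proof.
move=> d0; have [->|t0] := eqVneq t 0.
  (* The bound [8^-1] gives [|s| <= 3/8], inside the quadratic range. *)
  exists (Num.min (d ^+ 2) 8^-1) => [|s _]; first by rewrite lt_min exprn_gt0//; lra.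
  rewrite huber0 add0r subr0 le_min => /andP[h1 h2].
  have := huber_gt s => h3.
  move: h1; rewrite /huber ifT; last by lra.
  rewrite -[s ^+ 2]real_normK ?num_real// ler_pXn2r ?nnegrE ?(ltW d0)//.
have m0 : 0 < `|dhuber t|.
  rewrite normr_gt0; case: (cases t) => [[_ _ _ ->]|[_ _ ->]|[_ _ ->]];
  by rewrite ?oppr_eq0 ?oner_eq0// mulf_neq0.
exists (`|dhuber t| * d) => [|s]; first exact: mulr_gt0.
by rewrite normrM ler_pM2l.
Qed.

End Huber.

(** * Finite-dimensional spans *)

Section FiniteSpans.
Variables (R : realType) (X : normedModType R).
Implicit Types (l : seq X) (x s z v : X).

(** One coefficient is peeled off per vector, so induction on the list replaces induction on the
    dimension, and dependent vectors are allowed. *)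
Fixpoint spn l x : Prop :=
  if l is v :: l' then exists t : R, spn l' (x - t *: v) else x = 0.

Lemma spn0 l : spn l 0.
Proof. by elim: l => [//|v l IH]; exists 0; rewrite scale0r subr0. Qed.

Lemma spnD l x y : spn l x -> spn l y -> spn l (x + y).
Proof.
elim: l x y => [|v l IH] x y /=; first by move=> -> ->; rewrite addr0.
move=> [t ht] [u hu]; exists (t + u).
by rewrite scalerDl opprD addrACA; exact: IH.
Qed.

Lemma spnZ l c x : spn l x -> spn l (c *: x).
Proof.
elim: l x => [|v l IH] x /=; first by move=> ->; rewrite scaler0.
by move=> [t ht]; exists (c * t); rewrite -scalerA -scalerBr; exact: IH.
Qed.

Lemma spnB l x y : spn l x -> spn l y -> spn l (x - y).
Proof. by move=> hx hy; apply: spnD => //; rewrite -scaleN1r; exact: spnZ. Qed.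

Lemma spn_mem l v : v \in l -> spn l v.
Proof.
elim: l => [//|w l IH]; rewrite inE => /predU1P[->|/IH h].
  by exists 1; rewrite scale1r subrr; exact: spn0.
by exists 0; rewrite scale0r subr0.
Qed.

Lemma spn_catl l l' x : spn l x -> spn (l ++ l') x.
Proof.
elim: l x => [|v l IH] x /=; first by move=> ->; exact: spn0.
by case=> t ht; exists t; exact: IH.
Qed.

Lemma spn_sum l (I : Type) (r : seq I) (P : pred I) (F : I -> X) :
  (forall i, P i -> spn l (F i)) -> spn l (\sum_(i <- r | P i) F i).
Proof.
by move=> h; apply: big_ind => //; [exact: spn0|move=> *; exact: spnD].
Qed.

Lemma spn_finite l : (forall x, spn l x) -> finite_dimensional X.
Proof.
move=> h; exists (size l), (fun i => l`_i) => x.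
have {h} := h x; elim: l x => [|v l IH] x /=.
  by move=> ->; exists (fun=> 0); rewrite big_ord0.
move=> [t /IH[c hc]].
exists (fun i => if unlift ord0 i is Some j then c j else t).
rewrite big_ord_recl unlift_none/=.
under eq_bigr do rewrite liftK.
by rewrite -hc addrC subrK.
Qed.

Lemma segment_net (T h : R) : 0 < h ->
  exists ts : seq R, forall t, `|t| <= T -> exists2 t', t' \in ts & `|t - t'| <= h.
Proof.
move=> h0; exists [seq i%:R * h - T | i <- iota 0 (Num.truncn (2 * T / h)).+1] => t.
rewrite ler_norml => /andP[t1 t2].
have tT : 0 <= (t + T) / h by rewrite divr_ge0 ?(ltW h0)//; lra.
exists ((Num.truncn ((t + T) / h))%:R * h - T).
  apply/mapP; exists (Num.truncn ((t + T) / h)) => //.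
  rewrite mem_iota/= add0n ltnS; apply: le_truncn.
  by rewrite ler_pM2r ?invr_gt0//; lra.
have /andP[] := truncn_itv tT.
set k := Num.truncn _; rewrite ler_pdivlMr// ltr_pdivrMr// -natr1 => h1 h2.
by rewrite ler_norml; apply/andP; split; nra.
Qed.

(** Total boundedness, by induction on the list. If [v] has positive distance from the span of the
    rest, its coefficient is bounded, and a net of coefficients is combined with a net of
    remainders; otherwise multiples of [v] are approximated within that span. *)
Lemma spn_net l (r eta : R) : 0 < eta ->
  exists N : seq X, forall s, spn l s -> `|s| <= r ->
    exists2 z, z \in N & `|s - z| <= eta.
Proof.
elim: l r eta => [|v l IH] r eta eta0.
  exists [:: 0] => s /= -> _; exists 0; rewrite ?inE// subrr normr0; exact: ltW.
have e20 : 0 < eta / 2 by rewrite divr_gt0.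
have [[D D0 hD]|/forall2NP hD] :=
    pselect (exists2 D : R, 0 < D & forall s, spn l s -> D <= `|v - s|).
  pose T := `|r| / D.
  have [N hN] := IH (`|r| + T * `|v|) _ e20.
  have [|ts hts] := @segment_net T (eta / 2 / (`|v| + 1)).
    by rewrite divr_gt0// ltr_wpDl.
  exists [seq z + t *: v | z <- N, t <- ts] => s [t ht] sr.
  have tT : `|t| <= T.
    rewrite ler_pdivlMr//; have [->|t0] := eqVneq t 0; first by rewrite normr0 mul0r.
    have := hD _ (spnZ (- t^-1) ht).
    rewrite scaleNr opprK scalerBr scalerA mulVf// scale1r addrC subrK normrZ normfV.
    rewrite ler_pdivlMl ?normr_gt0// => /le_trans; apply.
    by apply: (le_trans sr); exact: ler_norm.
  have [|z zN hz] := hN _ ht.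
    apply: (le_trans (ler_normB _ _)); rewrite normrZ lerD// ?ler_wpM2r//.
    by apply: (le_trans sr); exact: ler_norm.
  have [t' t'ts htt'] := hts _ tT.
  exists (z + t' *: v); first by apply/allpairsP; exists (z, t').
  have -> : s - (z + t' *: v) = (s - t *: v - z) + (t - t') *: v.
    by rewrite scalerBl opprD addrA addrACA -!addrA; congr (_ + _); rewrite addrCA addNKr.
  apply: (le_trans (ler_normD _ _)); rewrite normrZ [leRHS]splitr lerD//.
  have := htt'; rewrite ler_pdivlMr ?ltr_wpDl//; have := normr_ge0 (t - t').
  by nra.
(* Here [v] lies in the closure of the span of [l]. Replacing [v] by a close [s'] moves [s] by at
   most [1], hence the radius [r + 1], and by at most [eta / 2]. *)
have [N hN] := IH (r + 1) _ e20.
exists N => s [t ht] sr.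
have m0 : 0 < Num.min 1 (eta / 2) by rewrite lt_min ltr01.
have d0 : 0 < Num.min 1 (eta / 2) / (`|t| + 1) by rewrite divr_gt0// ltr_wpDl.
have [//|hs] := hD (Num.min 1 (eta / 2) / (`|t| + 1)).
have [s' [ls' hs']] : exists s', spn l s' /\ `|v - s'| < Num.min 1 (eta / 2) / (`|t| + 1).
  apply: contrapT => H; apply: hs => s' ls'; rewrite leNgt; apply/negP => hs'.
  by apply: H; exists s'.
have hd : `|s - (s - t *: v + t *: s')| <= Num.min 1 (eta / 2).
  have -> : s - (s - t *: v + t *: s') = t *: (v - s').
    by rewrite scalerBr opprD opprB addrA addrCA subrr addr0.
  move: hs'; rewrite normrZ ltr_pdivlMr ?ltr_wpDl//.
  have := normr_ge0 (v - s'); have := normr_ge0 t; nra.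
move: hd; rewrite le_min => /andP[hd1 hd2].
have [||z zN hz] := hN (s - t *: v + t *: s').
- by apply: spnD => //; exact: spnZ.
- rewrite -[X in `|X|](subKr s) (le_trans (ler_normB _ _))// lerD//.
exists z => //; rewrite -(subrKA (s - t *: v + t *: s')) [eta]splitr.
by rewrite (le_trans (ler_normD _ _))// lerD.
Qed.

Variables (d : nat -> X) (f : nat -> X -> R).
Hypothesis d_dense : forall x (e : R), 0 < e -> exists j, `|x - d j| < e.
Hypothesis f_lin : forall j, is_lin (f j).
Hypothesis f_le : forall j x, `|f j x| <= `|x|.
Hypothesis f_d : forall j, f j (d j) = `|d j|.

(** By homogeneity, a finite net of the unit ball of the span suffices. A unit vector within [1/4]
    of [d j] has [f j] at least [3/4 - 1/4], whence the factor [2]; [J] bounds the finitely many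
    indices used. *)
Lemma spn_norming l : exists J, forall s, spn l s ->
  exists2 j, (j <= J)%N & `|s| <= 2 * `|f j s|.
Proof.
have [N hN] := @spn_net l 1 8^-1 (ltac:(by rewrite invr_gt0)).
have /choice[j hj] x : exists j, `|x - d j| < 8^-1 by apply: d_dense; rewrite invr_gt0.
exists (\max_(z <- N) j z)%N => s ls.
have [->|s0] := eqVneq s 0; first by exists 0%N => //; rewrite normr0 mulr_ge0.
have ns : 0 < `|s| by rewrite normr_gt0.
have [||z zN hz] := hN (`|s|^-1 *: s); first exact: spnZ.
  by rewrite normrZ normfV normr_id mulVf ?gt_eqF.
exists (j z); first by rewrite (big_rem z)//= leq_maxl.
set s1 := _ *: s in hz.
have ss1 : s = `|s| *: s1 by rewrite scalerA mulfV ?gt_eqF// scale1r.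
have -> : f (j z) s = `|s| * f (j z) s1 by rewrite {1}ss1 is_linZ.
rewrite normrM normr_id mulrCA ler_peMr ?(ltW ns)//.
have n1 : `|s1| = 1 by rewrite normrZ normfV normr_id mulVf ?gt_eqF.
have h1 : `|s1 - d (j z)| <= 4^-1.
  rewrite -(subrKA z); apply: (le_trans (ler_normD _ _)); have := hj z; lra.
have h2 : 1 - 4^-1 <= `|d (j z)|.
  by have := ler_normD (s1 - d (j z)) (d (j z)); rewrite subrK n1; lra.
have h3 := f_le (j z) (s1 - d (j z)).
have h4 := ler_norm (f (j z) s1).
by move: h3; rewrite is_linB// f_d ler_norml => /andP[h3 _]; lra.
Qed.

End FiniteSpans.

(** * Common kernels and almost orthogonal vectors *)

Section CommonKernel.
Variables (R : realType) (X : normedModType R).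

(** The common kernel has finite codimension: modulo it every vector lies in the span of a list [l].
    If it were trivial, [l] would span the space. *)
Lemma common_kernel (L : seq (X -> R)) : infinite_dimensional X ->
  (forall h, h \in L -> is_lin h) ->
  exists2 y : X, `|y| = 1 & forall h, h \in L -> h y = 0.
Proof.
move=> Xinf Llin.
have [l hl] : exists l, forall x, exists2 s, spn l s & forall h, h \in L -> h (x - s) = 0.
  elim: L Llin => [|h L IH] Llin; first by exists [::] => x; exists 0.
  have [|l hl] := IH; first by move=> k kL; apply: Llin; rewrite inE kL orbT.
  have lh : is_lin h by apply: Llin; rewrite inE eqxx.
  have [[v [hv v0]]|nv] :=
    pselect (exists v, (forall k, k \in L -> k v = 0) /\ h v != 0); last first.
    exists l => x; have [s ls hs] := hl x; exists s => // k.
    rewrite inE => /predU1P[->|/hs//]; apply: contrapT => /eqP n.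
    by apply: nv; exists (x - s).
  exists (v :: l) => x; have [s ls hs] := hl x.
  exists (s + (h (x - s) / h v) *: v) => [|k].
    by exists (h (x - s) / h v); rewrite addrK.
  rewrite opprD addrA inE => /predU1P[->|kL].
    by rewrite (is_linB _ _ lh) (is_linZ _ _ lh) divfK// subrr.
  have lk : is_lin k by apply: Llin; rewrite inE kL orbT.
  by rewrite (is_linB _ _ lk) (is_linZ _ _ lk) (hs _ kL) (hv _ kL) mulr0 subr0.
have [y [y0 hy]] : exists y, y != 0 /\ forall h, h \in L -> h y = 0.
  apply: contrapT => n; apply: Xinf; apply: (@spn_finite _ _ l) => x.
  have [s ls hs] := hl x; suff -> : x = s by [].
  apply/eqP; rewrite -subr_eq0; apply: contrapT => /negP xs.
  by apply: n; exists (x - s).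
exists (`|y|^-1 *: y) => [|h hL].
  by rewrite normrZ normfV normr_id mulVf// normr_eq0.
by rewrite (is_linZ _ _ (Llin _ hL)) (hy _ hL) mulr0.
Qed.

Variables (Xsep : separable_space X) (Xinf : infinite_dimensional X).

Lemma sublinear_norm : sublinear (fun x : X => `|x|).
Proof.
split=> [x y|t x t0]; first exact: ler_normD.
by rewrite normrZ ger0_norm.
Qed.

Lemma norming_functional (x : X) :
  exists f, [/\ is_lin f, forall y, `|f y| <= `|y| & f x = `|x|].
Proof.
have [f [lf fn fx]] := hahn_banach x sublinear_norm.
exists f; split=> // y; rewrite ler_norml fn andbT.
by have := fn (- y); rewrite normrN (is_linN y lf); lra.
Qed.

Lemma dense_sequence :
  exists d : nat -> X, forall x (e : R), 0 < e -> exists j, `|x - d j| < e.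
Proof.
have [D [cD dD]] := Xsep.
have /pfcard_geP[D0|/unsquash d] := cD.
  by have := dD setT (ex_intro _ 0 I) openT; rewrite D0 setI0 => -[].
exists d => x e e0.
have [||y [xy Dy]] := dD (ball x e).
- by exists x; exact: ballxx.
- exact: ball_open.
have [j _ dj] := (@surj _ _ _ _ d) y Dy.
by exists j; rewrite dj -ball_normE in xy *.
Qed.

(* The functional comes from Hahn-Banach for the distance to [spn l], which is
   at least 1/3 at a unit vector killed by functionals norming [spn l]. *)
Lemma almost_orthogonal (l : seq X) (L : seq (X -> R)) :
  (forall h, h \in L -> is_lin h) ->
  exists y g, [/\ `|y| = 1, forall h, h \in L -> h y = 0, is_lin g,
    g y = 1 & (forall x, `|g x| <= 3 * `|x|) /\ forall s, spn l s -> g s = 0].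
Proof.
move=> Llin; have [d dd] := dense_sequence.
have /choice[f hf] j : exists f, [/\ is_lin f, forall y, `|f y| <= `|y| & f (d j) = `|d j|].
  exact: norming_functional.
have fl j : is_lin (f j) by case: (hf j).
have fle j x : `|f j x| <= `|x| by case: (hf j).
have [J hJ] := spn_norming dd fl fle (fun j => let: And3 _ _ h := hf j in h) l.
have [h|y y1 hy] := @common_kernel (L ++ [seq f j | j <- iota 0 J.+1]) Xinf.
  by rewrite mem_cat => /orP[/Llin//|/mapP[j _ ->]].
have Ly h : h \in L -> h y = 0 by move=> hL; apply: hy; rewrite mem_cat hL.
have fy j : (j <= J)%N -> f j y = 0.
  by move=> jJ; apply: hy; rewrite mem_cat map_f ?orbT// mem_iota.
(* The functional norming [s] vanishes at [y], so [|y - s| >= |s| / 2], while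
   [|s| >= 1 - |y - s|]. *)
have far s : spn l s -> 3^-1 <= `|y - s|.
  move=> /hJ[j /fy jy hs].
  have := fle j (y - s); rewrite is_linB// jy sub0r normrN.
  by have := ler_normD (y - s) s; rewrite subrK y1; lra.
pose P x := infr (spn l) (fun s => `|x - s|).
have P_le x s : spn l s -> P x <= `|x - s|.
  by apply: (@infr_le _ _ _ (fun s => `|x - s|) 0) => *; exact: normr_ge0.
have P_ge x c : (forall s, spn l s -> c <= `|x - s|) -> c <= P x.
  by move=> h; apply: (le_infr (spn0 l)).
have sP : sublinear P.
  split=> [x z|t x t0].
    rewrite -lerBlDr; apply: (P_ge) => s ls; rewrite lerBlDr -lerBlDl.
    apply: (P_ge) => s' ls'; rewrite lerBlDl.
    apply: (le_trans (P_le _ (s + s') (spnD ls ls'))).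
    by rewrite opprD addrACA ler_normD.
  move: t0; rewrite le_eqVlt => /predU1P[<-|t0].
    rewrite scale0r mul0r; apply/le_anti/andP; split.
      by have := P_le 0 0 (spn0 _); rewrite subrr normr0.
    by apply: (P_ge) => *; exact: normr_ge0.
  apply/le_anti/andP; split.
    rewrite -ler_pdivrMl//; apply: (P_ge) => s ls; rewrite ler_pdivrMl//.
    apply: (le_trans (P_le _ _ (spnZ t ls))).
    by rewrite -scalerBr normrZ gtr0_norm.
  apply: (P_ge) => s ls; rewrite -ler_pdivlMl//.
  apply: (le_trans (P_le _ _ (spnZ t^-1 ls))).
  rewrite -[X in X - _](@scalerK _ _ t) ?gt_eqF// -scalerBr normrZ.
  by rewrite normfV gtr0_norm.
have Py : 3^-1 <= P y by apply: (P_ge) => s; exact: far.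
have Py0 : 0 < P y by lra.
have [g [lg gP gy]] := hahn_banach y sP.
have Pn x : P x <= `|x| by have := P_le x 0 (spn0 _); rewrite subr0.
have Ps s : spn l s -> P s <= 0 by move=> ls; have := P_le s s ls; rewrite subrr normr0.
(* Division by [P y >= 1/3] normalises the value at [y] to [1] and yields the constant [3]. *)
exists y, (fun x => (P y)^-1 * g x); split=> //.
- by move=> a x z; rewrite lg; ring.
- by rewrite gy mulVf// gt_eqF.
split=> [x|s ls].
  rewrite normrM normfV (gtr0_norm Py0).
  have gx : `|g x| <= `|x|.
    rewrite ler_norml (le_trans (gP _) (Pn _)) andbT.
    by have := le_trans (gP _) (Pn (- x)); rewrite normrN (is_linN _ lg); lra.
  rewrite ler_pdivrMl//; have := normr_ge0 x; nra.
suff -> : g s = 0 by rewrite mulr0.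
apply/le_anti; rewrite (le_trans (gP _) (Ps _ ls))/=.
have := le_trans (gP _) (Ps _ (spnZ (-1) ls)).
by rewrite (is_linZ _ _ lg); lra.
Qed.

End CommonKernel.

(** * The auxiliary norm and sequences *)

(* In the notation of the introduction, [fnorm], [fgen], [fcoord0] and [ffar] are
   [p], [e], [f0] and [y]; [fcoord j - fcoord j (fgen 0) * fcoord0] is proportional
   to [c_j]. *)
Record frame (R : realType) (X : normedModType R) := Frame {
  fnorm : X -> R ;
  fgen : nat -> X ;
  fcoord0 : X -> R ;
  fcoord : nat -> X -> R ;
  ffar : nat -> X ;
  fnormD : forall x y, fnorm (x + y) <= fnorm x + fnorm y ;
  fnormZ : forall a x, fnorm (a *: x) = `|a| * fnorm x ;
  fnorm_ge : forall x, `|x| <= fnorm x ;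
  fnorm_le : forall x, fnorm x <= 3 * `|x| ;
  fgen0 : `|fgen 0%N| = 1 ;
  fgen_le : forall i, (0 < i)%N -> fnorm (fgen i) <= (2 ^+ i)^-1 ;
  fgen_dense : forall x (e : R), 0 < e -> exists i c, fnorm (x - c *: fgen i) < e ;
  fcoord0_lin : is_lin fcoord0 ;
  fcoord0_le : forall x, `|fcoord0 x| <= `|x| ;
  fcoord0_gen : fcoord0 (fgen 0%N) = 1 ;
  fcoord_lin : forall j, is_lin (fcoord j) ;
  fcoord_le : forall j x, `|fcoord j x| <= `|x| ;
  fcoord_norming : forall k, exists J, forall s, spn [seq fgen i | i <- iota 0 k.+1] s ->
    exists2 j, (j <= J)%N & `|s| <= 2 * `|fcoord j s| ;
  ffar0 : forall n, fcoord0 (ffar n) = 0 ;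
  ffar_coord : forall n j, (j < n)%N -> fcoord j (ffar n) = 0 ;
  ffar_le : forall n, fnorm (ffar n) <= 1 ;
  ffar_ge : forall n s t, spn [seq fgen i | i <- iota 0 n.+1] s -> 0 <= t ->
    t <= fnorm (t *: ffar n - s) }.

Section FrameExistence.
Variables (R : realType) (X : normedModType R).
Variables (Xsep : separable_space X) (Xinf : infinite_dimensional X).

Section FarSequence.
Variables (e : nat -> X) (f0 : X -> R) (f : nat -> X -> R).
Hypothesis f0_lin : is_lin f0.
Hypothesis f_lin : forall j, is_lin (f j).

(** Orthogonality with the earlier pairs is required in both directions, so that the pairs built in
    turn are biorthogonal; the length of the history [s] serves as the current index. *)
Let step_spec (s : seq (X * (X -> R))) (q : X * (X -> R)) : Prop :=
  [/\ `|q.1| <= 1 /\ f0 q.1 = 0,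
      forall j, (j < size s)%N -> f j q.1 = 0,
      [/\ is_lin q.2, q.2 q.1 = 1 & forall x, `|q.2 x| <= 3 * `|x|],
      forall t, spn [seq e i | i <- iota 0 (size s).+1] t -> q.2 t = 0
    & forall r, r \in s -> r.2 q.1 = 0 /\ q.2 r.1 = 0].

Let step_exists s : (forall r, r \in s -> is_lin r.2) -> exists q, step_spec s q.
Proof.
move=> slin.
pose l := [seq e i | i <- iota 0 (size s).+1] ++ [seq r.1 | r <- s].
pose L := f0 :: [seq f j | j <- iota 0 (size s)] ++ [seq r.2 | r <- s].
have [h|y [g [y1 hy lg gy [gn gs]]]] := @almost_orthogonal _ _ Xsep Xinf l L.
  rewrite inE mem_cat => /predU1P[->//|/orP[/mapP[j _ ->]//|/mapP[r rs ->]]].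
  exact: slin.
exists (y, g); split=> /=.
- by rewrite y1 hy// inE eqxx.
- by move=> j js; apply: hy; rewrite inE mem_cat map_f ?orbT// mem_iota.
- by split.
- move=> t ht; apply: gs; exact: spn_catl.
- move=> r rs; split; first by apply: hy; rewrite inE mem_cat; apply/or3P/Or33/mapP; exists r.
  by apply: gs; apply: spn_mem; rewrite mem_cat; apply/orP; right; apply/mapP; exists r.
Qed.

Lemma far_sequence : exists (y : nat -> X) (g : nat -> X -> R),
  [/\ forall n, `|y n| <= 1 /\ f0 (y n) = 0,
      forall n j, (j < n)%N -> f j (y n) = 0,
      forall n, is_lin (g n) /\ forall x, `|g n x| <= 3 * `|x|,
      forall n t, spn [seq e i | i <- iota 0 n.+1] t -> g n t = 0
    & forall n m, g n (y m) = (n == m)%:R].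
Proof.
(* The choice function is total on lists; the pair of zeros is a default for lists with a nonlinear
   component. *)
have /choice[nxt hnxt] s : exists q, (forall r, r \in s -> is_lin r.2) -> step_spec s q.
  have [h|h] := pselect (forall r, r \in s -> is_lin r.2); last by exists (0, fun=> 0).
  by have [q hq] := step_exists h; exists q.
pose build := fix build n := if n is m.+1 then rcons (build m) (nxt (build m)) else [::].
have size_build n : size (build n) = n.
  by elim: n => [//|n IH]; rewrite /= size_rcons IH.
have build_lin n r : r \in build n -> is_lin r.2.
  elim: n r => [//|n IH] r; rewrite /= mem_rcons inE => /predU1P[->|]; last exact: IH.
  by have [_ _ []] := hnxt _ IH.
have spec n := hnxt _ (@build_lin n).
have mem_build m n : (m < n)%N -> nxt (build m) \in build n.
  elim: n => [//|n IH]; rewrite ltnS leq_eqVlt => /predU1P[->|/IH h] /=;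
  by rewrite mem_rcons inE ?eqxx// h orbT.
exists (fun n => (nxt (build n)).1), (fun n => (nxt (build n)).2).
split=> [n|n j jn|n|n t|n m].
- by have [] := spec n.
- by have [_ h _ _ _] := spec n; apply: h; rewrite size_build.
- by have [_ _ [] ] := spec n.
- by have [_ _ _ h _] := spec n; rewrite size_build in h; exact: h.
- have [mn|nm|->] := ltngtP.
  + by have [_ _ _ _ /(_ _ (mem_build _ _ mn))[]] := spec m.
  + by have [_ _ _ _ /(_ _ (mem_build _ _ nm))[]] := spec n.
  + by have [_ _ []] := spec m.
Qed.

End FarSequence.

Lemma frame_exists : inhabited (frame X).
Proof.
have [d dd] := dense_sequence Xsep.
have /choice[f hf] j : exists f, [/\ is_lin f, forall y, `|f y| <= `|y| & f (d j) = `|d j|].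
  exact: norming_functional.
have fl j : is_lin (f j) by case: (hf j).
have fle j x : `|f j x| <= `|x| by case: (hf j).
have [e0 e01 _] := @common_kernel _ X [::] Xinf (fun _ => ltac:(by [])).
have [f0 [f0l f0le f0e]] := norming_functional e0.
(* This factor makes [3 * |e i| <= 2^-i] for [i > 0]; density survives the rescaling because
   [fgen_dense] allows scalar multiples. *)
pose c i : R := (2 ^+ i.+1 * (3 * (`|d i| + 1)))^-1.
have c0 i : 0 < c i by rewrite invr_gt0 !mulr_gt0 ?exprn_gt0// ltr_wpDl.
pose e i := if i is j.+1 then c j *: d j else e0.
have [y [g [hy fy hg gs gy]]] := far_sequence e f0l fl.
(* [p] is the supremum of the norm and of all [|g m|], written as minus an infimum, with index [0]
   for the norm. Biorthogonality and [|y n| <= 1] give [p (y n) <= 1]; [g n], which kills the first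
   [n + 1] generators, gives [ffar_ge]. *)
pose p x := - infr setT (fun n => - if n is m.+1 then `|g m x| else `|x|).
have q3 x n : (if n is m.+1 then `|g m x| else `|x|) <= 3 * `|x|.
  case: n => [|n]; last by have [] := hg n.
  by have := normr_ge0 x; lra.
have p_ge x n : (if n is m.+1 then `|g m x| else `|x|) <= p x.
  rewrite lerNr; apply: (@infr_le _ _ _ _ (- (3 * `|x|))) => // j _.
  by rewrite lerN2.
have p_le x r : (forall n, (if n is m.+1 then `|g m x| else `|x|) <= r) -> p x <= r.
  by move=> h; rewrite lerNl; apply: (@le_infr _ _ _ _ _ 0%N) => // j _; rewrite lerN2.
have pD x z : p (x + z) <= p x + p z.
  apply: (p_le) => -[|n]; first by rewrite (le_trans (ler_normD _ _))// lerD// (p_ge _ 0%N).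
  rewrite (is_linD _ _ (hg n).1) (le_trans (ler_normD _ _))// lerD//.
    exact: (p_ge _ n.+1).
  exact: (p_ge _ n.+1).
have pZ' a x : p (a *: x) <= `|a| * p x.
  apply: (p_le) => -[|n]; first by rewrite normrZ ler_wpM2l// (p_ge _ 0%N).
  by rewrite (is_linZ _ _ (hg n).1) normrM ler_wpM2l// (p_ge _ n.+1).
have pZ a x : p (a *: x) = `|a| * p x.
  apply/le_anti; rewrite pZ'/=; have [->|a0] := eqVneq a 0.
    by rewrite normr0 mul0r (le_trans _ (p_ge _ 0%N)).
  rewrite -ler_pdivlMl ?normr_gt0// -normfV.
  by rewrite -{1}[x](@scalerK _ _ a)//.
have pn x : p x <= 3 * `|x| by apply: (p_le).
have ce i : (0 < i)%N -> 3 * `|e i| <= (2 ^+ i)^-1.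
  case: i => // i _ /=; rewrite normrZ (gtr0_norm (c0 i)) /c.
  have d1 : 0 < `|d i| + 1 by rewrite ltr_wpDl.
  have -> : 3 * ((2 ^+ i.+1 * (3 * (`|d i| + 1)))^-1 * `|d i|) =
            (2 ^+ i.+1)^-1 * (`|d i| / (`|d i| + 1)).
    by field; rewrite (gt_eqF d1) expf_neq0.
  by rewrite ler_piMr ?(ltW (w_gt0 _ _))// ler_pdivrMr// mul1r lerDl.
split; apply: (@Frame _ _ p e f0 f y) => //.
- by move=> x; exact: (p_ge _ 0%N).
- by move=> i i0; apply: (le_trans (pn _)); exact: ce.
- move=> x r r0; have [j hj] := dd x (r / 3) (divr_gt0 r0 (ltr0n R 3)).
  exists j.+1, (c j)^-1; rewrite /= scalerK ?gt_eqF//.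
  by apply: (le_lt_trans (pn _)); rewrite -ltr_pdivlMl// mulrC.
- by rewrite f0e e01.
- by move=> k; apply: (spn_norming dd) => // j; case: (hf j).
- by move=> n; have [] := hy n.
- move=> n; apply: (p_le) => -[|m]; first by have [] := hy n.
  by rewrite gy; case: eqP => _; rewrite ?normr1 ?normr0.
- move=> n s t hs t0; apply: le_trans (p_ge _ n.+1).
  rewrite (is_linB _ _ (hg n).1) (is_linZ _ _ (hg n).1) gy eqxx gs// subr0 mulr1.
  exact: ler_norm.
Qed.

End FrameExistence.

(** * Gauge norms *)

(** Gateaux differentiability of a convex function, stated as an upper bound because convexity makes
    the second difference nonnegative. *)
Definition gsmooth (R : realType) (X : lmodType R) (phi : X -> R) :=
  forall x v e, 0 < e -> exists2 d, 0 < d & forall h, 0 < h < d ->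
    phi (x + h *: v) + phi (x - h *: v) - 2 * phi x <= e * h.

Section Gauge.
Variables (R : realType) (X : normedModType R) (phi : X -> R) (L r : R).
Hypothesis L0 : 0 < L.
Hypothesis r0 : 0 < r.
Hypothesis phi_cvx : cvx phi.
Hypothesis phiN : forall x, phi (- x) = phi x.
Hypothesis phi0 : phi 0 = 0.
Hypothesis phi_lip : forall x y, `|phi x - phi y| <= L * `|x - y|.
Hypothesis phi_bnd : forall x, phi x <= 1 -> `|x| <= r.

Definition gauge x := infr [set l | 0 < l /\ phi (l^-1 *: x) <= 1] id.

Let adm x : 0 < L * `|x| + 1 /\ phi ((L * `|x| + 1)^-1 *: x) <= 1.
Proof.
have h : 0 < L * `|x| + 1 by rewrite ltr_wpDl// mulr_ge0// ltW.
split=> //; have := phi_lip ((L * `|x| + 1)^-1 *: x) 0.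
rewrite phi0 !subr0 normrZ normfV (gtr0_norm h) => /(le_trans (ler_norm _)) /le_trans; apply.
by rewrite mulrCA ler_pdivrMl// mulr1 lerDl.
Qed.

Let phiZ t x : 0 <= t <= 1 -> phi (t *: x) <= t * phi x.
Proof. by move=> /(phi_cvx x 0); rewrite scaler0 addr0 phi0 mulr0 addr0. Qed.

Lemma gauge_le x l : 0 < l -> phi (l^-1 *: x) <= 1 -> gauge x <= l.
Proof. by move=> l0 h; apply: (@infr_le _ _ _ id 0) => // j [] /ltW. Qed.

Lemma gauge_ge0 x : 0 <= gauge x.
Proof. by apply: (le_infr (adm x)) => j [/ltW]. Qed.

(** An admissible [m] exists below or slightly above [l]. Below, convexity and [phi 0 = 0] suffice;
    above, the margin is chosen so that the Lipschitz bound costs at most [e]. *)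
Lemma gauge_leP x l : 0 < l -> gauge x <= l -> phi (l^-1 *: x) <= 1.
Proof.
move=> l0 gl; apply/ler_addgt0Pr => e e0.
have K0 : 0 < L * `|x| + 1 by case: (adm x).
have hd : 0 < e * l ^+ 2 / (L * `|x| + 1) by rewrite divr_gt0// mulr_gt0// exprn_gt0.
have : gauge x < l + e * l ^+ 2 / (L * `|x| + 1) by rewrite ltr_pwDr.
move=> /(infr_lt (adm x))[m [m0 pm]] /= ml.
have lm0 : 0 < l^-1 * m by rewrite mulr_gt0 ?invr_gt0.
have [h|h] := leP m l.
  have -> : l^-1 *: x = (m / l) *: (m^-1 *: x) by rewrite scalerA mulrAC mulfV ?gt_eqF// mul1r.
  have t01 : 0 <= m / l <= 1 by rewrite (divr_ge0 (ltW m0) (ltW l0))/= ler_pdivrMr// mul1r.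
  apply: (le_trans (phiZ _ t01)); case/andP: t01 => a b; nra.
have := phi_lip (l^-1 *: x) (m^-1 *: x); rewrite -scalerBl normrZ.
move=> /(le_trans (ler_norm _)) hl.
suff : L * (`|l^-1 - m^-1| * `|x|) <= e by lra.
have li : 0 < l^-1 - m^-1 by rewrite subr_gt0 ltf_pV2.
rewrite (gtr0_norm li).
have e1 : l^-1 - m^-1 = (m - l) / (l * m) by field; rewrite !gt_eqF.
have : l^-1 - m^-1 <= (m - l) / l ^+ 2.
  rewrite e1 ler_pM2l ?subr_gt0// lef_pV2 ?posrE ?mulr_gt0// ?exprn_gt0//.
  by rewrite expr2 ler_pM2l// ltW.
have : (m - l) / l ^+ 2 <= e / (L * `|x| + 1).
  rewrite ler_pdivrMr ?exprn_gt0// mulrAC; lra.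
move=> h1 h2; have {h1 h2} := le_trans h2 h1.
rewrite ler_pdivlMr// => h1; have := normr_ge0 x; nra.
Qed.

Let gauge_sum x y l m : 0 < l -> 0 < m -> gauge x <= l -> gauge y <= m ->
  gauge (x + y) <= l + m.
Proof.
move=> l0 m0 /(gauge_leP l0) h1 /(gauge_leP m0) h2.
apply: gauge_le; first exact: addr_gt0.
have := @cvx_comb _ _ phi l m (l^-1 *: x) (m^-1 *: y) phi_cvx (ltW l0) (ltW m0)
  (addr_gt0 l0 m0).
rewrite !scalerA !mulfV ?gt_eqF// !scale1r; set z := phi _; nra.
Qed.

Lemma gaugeD x y : gauge (x + y) <= gauge x + gauge y.
Proof.
apply/ler_addgt0Pr => e e0.
have -> : gauge x + gauge y + e = (gauge x + e / 2) + (gauge y + e / 2) by lra.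
have e2 : 0 < e / 2 by lra.
by apply: gauge_sum; rewrite ?ltr_wpDl ?gauge_ge0// lerDl ltW.
Qed.

Let gaugeZ_le a x : 0 < a -> gauge (a *: x) <= a * gauge x.
Proof.
move=> a0; rewrite -ler_pdivrMl//; apply: (le_infr (adm x)) => l [l0 pl].
rewrite ler_pdivrMl//=; apply: gauge_le; first exact: mulr_gt0.
by rewrite scalerA invfM mulrAC mulVf ?gt_eqF// mul1r.
Qed.

Let gaugeZ_pos a x : 0 < a -> gauge (a *: x) = a * gauge x.
Proof.
move=> a0; apply/le_anti; rewrite gaugeZ_le//= -ler_pdivlMl//.
by rewrite -{1}[x](@scalerK _ _ a) ?gt_eqF// gaugeZ_le// invr_gt0.
Qed.

Lemma gauge0 : gauge 0 = 0.
Proof.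
apply/le_anti; rewrite gauge_ge0 andbT; apply/ler_addgt0Pr => e e0.
by rewrite add0r; apply: gauge_le => //; rewrite scaler0 phi0.
Qed.

Let gaugeN x : gauge (- x) = gauge x.
Proof.
by rewrite /gauge; congr infr; apply/seteqP; split => l /= [l0];
  rewrite scalerN phiN.
Qed.

Lemma gaugeZ a x : gauge (a *: x) = `|a| * gauge x.
Proof.
have [a0|a0|->] := ltgtP a 0.
- by rewrite ltr0_norm// -gaugeZ_pos ?oppr_gt0// scaleNr gaugeN.
- by rewrite gtr0_norm// gaugeZ_pos.
- by rewrite scale0r gauge0 normr0 mul0r.
Qed.

Lemma gauge_ge x : r^-1 * `|x| <= gauge x.
Proof.
apply: (le_infr (adm x)) => l [l0 /phi_bnd].
by rewrite normrZ normfV (gtr0_norm l0) /= !ler_pdivrMl// mulrC.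
Qed.

Lemma gauge_leL x : gauge x <= L * `|x|.
Proof.
have [->|x0] := eqVneq x 0; first by rewrite gauge0 normr0 mulr0.
have l0 : 0 < L * `|x| by rewrite mulr_gt0// normr_gt0.
apply: gauge_le => //; have := phi_lip ((L * `|x|)^-1 *: x) 0.
rewrite phi0 !subr0 normrZ normfV (gtr0_norm l0) => /(le_trans (ler_norm _)) /le_trans; apply.
by rewrite mulrCA mulVf// gt_eqF.
Qed.

Lemma gauge_eq0 x : gauge x = 0 -> x = 0.
Proof.
move=> g0; have := gauge_ge x; rewrite g0 pmulr_rle0 ?invr_gt0// normr_le0.
by move/eqP.
Qed.

Lemma gauge_equiv : exists m M : R,
  [/\ 0 < m, 0 < M & forall x, m * `|x| <= gauge x <= M * `|x|].
Proof.
exists r^-1, L; split=> //; first by rewrite invr_gt0.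
by move=> x; rewrite gauge_ge gauge_leL.
Qed.

Definition gauge_norm : equiv_norm X := EquivNorm gaugeD gaugeZ gauge_eq0 gauge_equiv.

Lemma gauge_le1 x : gauge x <= 1 <-> phi x <= 1.
Proof.
split=> h; first by have := gauge_leP ltr01 h; rewrite invr1 scale1r.
by apply: gauge_le; rewrite ?invr1 ?scale1r.
Qed.

(** If [phi x < 1], the Lipschitz bound allows inflating [x] by a factor above [1]; if
    [gauge x < 1], then [phi x < 1] because [phi] is convex and vanishes at [0]. *)
Lemma gauge_eq1 x : gauge x = 1 <-> phi x = 1.
Proof.
split=> h.
  have : phi x <= 1 by apply/gauge_le1; rewrite h.
  rewrite le_eqVlt => /predU1P[//|p1]; exfalso.
  have K0 : 0 < L * `|x| + 1 by case: (adm x).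
  pose eta := (1 - phi x) / (L * `|x| + 1).
  have eta0 : 0 < eta by rewrite divr_gt0// subr_gt0.
  have e1 : 0 < 1 + eta by rewrite addr_gt0.
  suff : gauge x <= (1 + eta)^-1.
    by rewrite h leNgt invf_lt1// ltrDl eta0.
  apply: gauge_le; rewrite ?invr_gt0// invrK.
  have := phi_lip ((1 + eta) *: x) x; rewrite scalerDl scale1r addrAC subrr add0r.
  rewrite normrZ (gtr0_norm eta0) => /(le_trans (ler_norm _)).
  have : eta * (L * `|x| + 1) = 1 - phi x by rewrite divfK// gt_eqF.
  nra.
have : gauge x <= 1 by apply/gauge_le1; rewrite h.
rewrite le_eqVlt => /predU1P[//|/(infr_lt (adm x))[l [l0 pl]] /= l1]; exfalso.
have := phiZ (l^-1 *: x) (t := l); rewrite scalerA mulfV ?gt_eqF// scale1r h.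
rewrite (ltW l0) (ltW l1) => /(_ isT); nra.
Qed.

(** Convexity and [phi 0 = 0] compare [phi] at [x] with its value [1] at the normalisation of [x].
    Estimates on [phi] thereby pass to the norm. *)
Lemma gauge_dist1 x : `|gauge x - 1| <= `|phi x - 1|.
Proof.
have [->|x0] := eqVneq x 0; first by rewrite gauge0 phi0.
have g0 : 0 < gauge x.
  by rewrite lt_neqAle gauge_ge0 andbT eq_sym; apply: contra x0 => /eqP /gauge_eq0 ->.
have h : phi ((gauge x)^-1 *: x) = 1.
  by apply/gauge_eq1; rewrite gaugeZ_pos ?invr_gt0// mulVf// gt_eqF.
have [g1|g1] := leP (gauge x) 1.
  have := phiZ ((gauge x)^-1 *: x) (t := gauge x).
  rewrite scalerA mulfV ?gt_eqF// scale1r h (ltW g0) g1 => /(_ isT) h1.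
  by rewrite ler0_norm ?ler0_norm; lra.
have := phiZ x (t := (gauge x)^-1); rewrite h invr_ge0 (ltW g0) invf_le1// (ltW g1).
move=> /(_ isT); rewrite mulrC ler_pdivlMr// mul1r => h1.
by rewrite !ger0_norm; lra.
Qed.

Hypothesis phi_smooth : gsmooth phi.

(** A subgradient [f] at [x] has [f x >= 1]. In directions where [f] is negative, smoothness keeps
    [phi <= 1]; subtracting a multiple of [x] reduces other directions to that case, and the slopes
    obtained along [y] and [- y] add up to [e]. *)
Lemma gauge_smooth x y e : gauge x = 1 -> 0 < e -> exists2 d, 0 < d &
  forall h, 0 < h < d -> gauge (x + h *: y) + gauge (x - h *: y) - 2 <= e * h.
Proof.
move=> /gauge_eq1 px e0.
have [f [lf fx]] := subgradient x phi_cvx.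
have fx1 : 1 <= f x.
  by have := fx (- x); rewrite subrr phi0 px (is_linN _ lf); lra.
have fx0 : 0 < f x by lra.
have A v : f v < 0 -> exists2 d, 0 < d & forall h, 0 < h < d -> phi (x + h *: v) <= 1.
  move=> fv; have [|d d0 hd] := @phi_smooth x v (- f v); first by lra.
  exists d => // h hh; have := hd h hh; have := fx (- (h *: v)).
  by rewrite (is_linN _ lf) (is_linZ _ _ lf) px; lra.
have B v c : f v < c * f x ->
    exists2 d, 0 < d & forall h, 0 < h < d -> gauge (x + h *: v) <= 1 + h * c.
  move=> vc; have [|d d0 hd] := A (v - c *: x).
    by rewrite (is_linB _ _ lf) (is_linZ _ _ lf); lra.
  have c1 : 0 < `|c| + 1 by rewrite ltr_wpDl.
  exists (Num.min (2 * (`|c| + 1))^-1 (d / 2)).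
    by rewrite lt_min invr_gt0 mulr_gt0//= divr_gt0.
  move=> h /andP[h0]; rewrite lt_min => /andP[h1 h2].
  have hc : 2^-1 <= 1 + h * c.
    move: h1; rewrite -[ltRHS]mul1r ltr_pdivlMr ?mulr_gt0// => h1.
    have := ler_norm (- c); rewrite normrN; nra.
  have hc0 : 0 < 1 + h * c by lra.
  have -> : x + h *: v = (1 + h * c) *: (x + (h / (1 + h * c)) *: (v - c *: x)).
    rewrite scalerDr scalerA [(1 + h * c) * _]mulrC divfK ?gt_eqF//.
    rewrite scalerBr scalerDl scale1r scalerA.
    by rewrite addrACA subrr addr0.
  rewrite gaugeZ_pos// ler_piMr ?(ltW hc0)//; apply/gauge_le1/hd.
  rewrite divr_gt0//= ltr_pdivrMr//; nra.
have [|d1 d10 h1] := B y (f y / f x + e / 2).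
  by rewrite mulrDl divfK ?gt_eqF//; nra.
have [|d2 d20 h2] := B (- y) (- (f y / f x) + e / 2).
  by rewrite mulrDl mulNr divfK ?gt_eqF// (is_linN _ lf); nra.
exists (Num.min d1 d2) => [|h /andP[h0]]; first by rewrite lt_min d10.
rewrite lt_min => /andP[hd1 hd2].
have := h1 h; have := h2 h; rewrite h0 hd1 hd2 scalerN => /(_ isT) + /(_ isT); lra.
Qed.

End Gauge.

(** * Criteria for a renorming *)

(** If [x] lay strictly inside a segment of the ball, a small neighbourhood of [x] would miss both
    ends; a slice inside it would miss them too, and by linearity also [x]. *)
Lemma denting_extreme (R : realType) (X : normedModType R) (x : X) :
  denting_point x -> extreme_point (unit_ball X) x.
Proof.
move=> [x1 dx]; split; first by rewrite /unit_ball/= x1.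
move=> y z t Ky Kz /andP[t0 t1] xe.
have xy : x - y = (1 - t) *: (z - y).
  by rewrite xe scalerBr [in X in _ = _ - X]scalerBl scale1r opprB addrCA addrA.
have xz : x - z = t *: (y - z).
  by rewrite xe scalerBl scale1r addrA addrAC addrK scalerBr.
have [yz|yz] := eqVneq y z.
  split; apply/eqP; rewrite eq_sym -subr_eq0.
    by rewrite xy yz subrr scaler0.
  by rewrite xz yz subrr scaler0.
exfalso; pose e := Num.min t (1 - t) * `|y - z|.
have yz0 : 0 < `|y - z| by rewrite normr_gt0 subr_eq0.
have t1' : 0 < 1 - t by rewrite subr_gt0.
have e0 : 0 < e by rewrite mulr_gt0// lt_min t0.
have [S [[f [a [_ _ _ a0 SE]]] Sx SV]] := dx _ (nbhsx_ballx x _ e0).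
have out w : unit_ball X w -> e <= `|x - w| -> f w <= sup (f @` unit_ball X) - a.
  move=> Kw xw; rewrite leNgt; apply/negP => h.
  have /SV : S w by rewrite SE.
  by rewrite -ball_normE/= ltNge xw.
have hy : f y <= sup (f @` unit_ball X) - a.
  apply: out => //; rewrite xy normrZ (gtr0_norm t1') distrC ler_wpM2r//.
  by rewrite ge_min lexx orbT.
have hz : f z <= sup (f @` unit_ball X) - a.
  by apply: out => //; rewrite xz normrZ (gtr0_norm t0) ler_wpM2r// ge_min lexx.
move: Sx; rewrite SE => -[_].
have -> : f x = t * f y + (1 - t) * f z by rewrite xe linearD !linearZ.
rewrite ltNge => /negP; apply.
by set c := sup _ - a in hy hz *; nra.
Qed.

Section Renormed.
Variables (R : realType) (X : normedModType R) (N : equiv_norm X).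

Lemma renormed_denting (x : renormed N) : N x = 1 ->
  (forall e : R, 0 < e -> exists (f : X -> R) (a C : R),
    [/\ is_lin f, forall y, `|f y| <= C * N y, f x != 0, 0 < a
      & forall y : X, N y <= 1 -> f x - a < f y -> N (y - x) < e]) ->
  denting_point x.
Proof.
move=> Nx hx; split=> // V /nbhs_ballP[e /= e0 eV].
have [f [a [C [lf fC fx a0 fa]]]] := hx e e0.
pose g : renormed N -> R^o := f.
have lg : linear g by move=> k u v; exact: lf.
pose gM := GRing.isLinear.Build R (renormed N) R^o _ g lg.
pose F : {linear renormed N -> R^o} := HB.pack g gM.
have C0 : 0 <= C by have := fC x; rewrite Nx mulr1; apply: le_trans.
have ub : ubound (F @` unit_ball (renormed N)) C.
  move=> _ [y /= Ky <-]; apply: (le_trans (ler_norm _)); apply: (le_trans (fC y)).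
  by rewrite ler_piMr.
have fsup : f x <= sup (F @` unit_ball (renormed N)).
  apply: ub_le_sup; first by exists C.
  by exists x => //; rewrite /unit_ball/= renormedE Nx.
(* The parameter is measured from the supremum, so this choice puts the threshold at [f x - a]. *)
exists (slice (unit_ball (renormed N)) F (sup (F @` unit_ball (renormed N)) - f x + a)).
split.
- exists F, (sup (F @` unit_ball (renormed N)) - f x + a); split=> //.
  + apply: bounded_linear_continuous.
    exists C; split; first exact: num_real.
    move=> M CM; near=> y; apply: le_trans (ltW CM).
    rewrite [leLHS]/Num.norm/=.
    apply: (le_trans (fC y)); rewrite ler_piMr//.
    rewrite -[N y]/(`|y|); near: y.
    exact: nbhs0_le.
  + by exists x.
  + by exists C.
  + by rewrite ltr_wpDl// subr_ge0.
- split; first by rewrite /unit_ball/= renormedE Nx.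
  by rewrite /= opprD opprB addrA subrKC ltrBlDr ltrDl.
- move=> y [Ky]; rewrite opprD opprB addrA subrKC => hy.
  apply: eV; rewrite -ball_normE /= distrC renormedE; exact: fa.
Unshelve. all: by end_near. Qed.

(** The second difference is even in [h] and nonnegative by the triangle inequality, so an upper
    bound for [h > 0] suffices. *)
Lemma renormed_gateaux :
  (forall x y e, N x = 1 -> 0 < e -> exists2 d, 0 < d & forall h, 0 < h < d ->
     N (x + h *: y) + N (x - h *: y) - 2 <= e * h) ->
  gateaux_smooth (renormed N).
Proof.
move=> H x y x1 _; apply/cvgrPdist_le => e e0.
have [d d0 hd] := H x y e x1 e0.
near=> h; rewrite sub0r normrN normrM normfV.
have h0 : h != 0 by near: h; exact: nbhs_dnbhs_neq.
rewrite ler_pdivrMr ?normr_gt0// !renormedE.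
have hlt : `|h| < d by near: h; exact: dnbhs0_lt.
rewrite ger0_norm.
  have -> : N (x + h *: y) + N (x - h *: y) = N (x + `|h| *: y) + N (x - `|h| *: y).
    have [h1|h1] := leP 0 h; first by rewrite ger0_norm.
    by rewrite ltr0_norm// scaleNr opprK addrC.
  by apply: hd; rewrite normr_gt0 h0.
have := enormD N (x + h *: y) (x - h *: y).
rewrite addrACA subrr addr0 -mulr2n -scaler_nat enormZ ger0_norm// (x1 : N x = 1).
by lra.
Unshelve. all: by end_near. Qed.

Lemma renormed_not_LUR (x : X) (u : nat -> X) (c : R) : N x = 1 -> 0 < c ->
  (forall n, c <= N (u n - x)) ->
  (forall e, 0 < e -> exists n0, forall n, (n0 <= n)%N ->
    `|N (u n) - 1| <= e /\ `|N (2^-1 *: (x + u n)) - 1| <= e) ->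
  ~ LUR (renormed N).
Proof.
move=> Nx c0 far near1 /(_ x Nx)[_ /(_ u) hu].
have c1 : N (u n) @[n --> \oo] --> (1 : R).
  apply/cvgrPdist_le => e e0; have [n0 hn] := near1 e e0.
  near=> n; rewrite distrC; apply: (hn n _).1; near: n; exact: nbhs_infty_ge.
have c2 : N (2^-1 *: (x + u n)) @[n --> \oo] --> (1 : R).
  apply/cvgrPdist_le => e e0; have [n0 hn] := near1 e e0.
  near=> n; rewrite distrC; apply: (hn n _).2; near: n; exact: nbhs_infty_ge.
have /hu : (2 * `|x : renormed N| ^+ 2 + 2 * `|u n : renormed N| ^+ 2
    - `|(x : renormed N) + u n| ^+ 2) @[n --> \oo] --> (0 : R).
  have -> : (0 : R) = 2 * 1 ^+ 2 + 2 * 1 ^+ 2 - (2 * 1) ^+ 2 by ring.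
  have -> : (fun n => 2 * `|x : renormed N| ^+ 2 + 2 * `|u n : renormed N| ^+ 2
              - `|(x : renormed N) + u n| ^+ 2) =
            (fun n => 2 * 1 ^+ 2 + 2 * N (u n) ^+ 2 - (2 * N (2^-1 *: (x + u n))) ^+ 2).
    apply/funext => n; rewrite !renormedE Nx enormZ ger0_norm//.
    by rewrite mulVKf.
  apply: cvgB; last first.
    by rewrite !expr2; apply: cvgM; apply: cvgM => //; exact: cvg_cst.
  apply: cvgD; first exact: cvg_cst.
  by apply: cvgM; [exact: cvg_cst|rewrite expr2; exact: cvgM].
move=> /cvgrPdist_lt /(_ c c0) [n0 _ /(_ n0 (leqnn _))].
by rewrite /= distrC renormedE ltNge far.
Unshelve. all: by end_near. Qed.

End Renormed.

(** * Smoothed distances *)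

Section SmoothedDistance.
Variables (R : realType) (X : normedModType R) (F : frame X).
Let p := fnorm F.
Let e := fgen F.
Implicit Types (a b : {poly R}) (x y v : X).

Let p0 : p 0 = 0.
Proof. by rewrite -(scale0r (0 : X)) /p fnormZ normr0 mul0r. Qed.

Let pN x : p (- x) = p x.
Proof. by rewrite -scaleN1r /p fnormZ normrN1 mul1r. Qed.

Let p_ge0 x : 0 <= p x.
Proof. exact: le_trans (fnorm_ge F x). Qed.

Lemma poly_sum_widen (V : nmodType) (f : nat -> R -> V) a N :
  (forall i, f i 0 = 0) -> (size a <= N)%N ->
  \sum_(i < size a) f i a`_i = \sum_(i < N) f i a`_i.
Proof.
move=> f0 aN; rewrite (big_ord_widen N (fun i => f i a`_i))// big_mkcond.
by apply: eq_bigr => i _; case: ltnP => // h; rewrite nth_default.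
Qed.

(* Polynomials serve as finitely supported coefficient sequences. *)
Definition fcomb a : X := \sum_(i < size a) a`_i *: e i.
Definition fcost k a : R := \sum_(i < size a) (k < i)%:R * a`_i ^+ 2.

Lemma fcomb_widen N a : (size a <= N)%N -> fcomb a = \sum_(i < N) a`_i *: e i.
Proof.
by apply: (@poly_sum_widen _ (fun i c => c *: e i)) => i; rewrite scale0r.
Qed.

Lemma fcost_widen k N a : (size a <= N)%N ->
  fcost k a = \sum_(i < N) (k < i)%:R * a`_i ^+ 2.
Proof.
apply: (@poly_sum_widen _ (fun i c => (k < i)%:R * c ^+ 2)) => i.
by rewrite expr0n mulr0.
Qed.

Lemma fcombD a b : fcomb (a + b) = fcomb a + fcomb b.
Proof.
rewrite (@fcomb_widen (maxn (size a) (size b)) a) ?leq_maxl//.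
rewrite (@fcomb_widen (maxn (size a) (size b)) b) ?leq_maxr//.
rewrite (fcomb_widen (size_polyD _ _)) -big_split/=.
by apply: eq_bigr => i _; rewrite coefD scalerDl.
Qed.

Lemma fcombZ c a : fcomb (c *: a) = c *: fcomb a.
Proof.
rewrite (fcomb_widen (size_scale_leq _ _)) scaler_sumr.
by apply: eq_bigr => i _; rewrite coefZ scalerA.
Qed.

Lemma fcombXn i : fcomb 'X^i = e i.
Proof.
rewrite (@fcomb_widen i.+1) ?size_polyXn// big_ord_recr/= big1 ?add0r.
  by rewrite coefXn eqxx scale1r.
by move=> j _; rewrite coefXn ltn_eqF// scale0r.
Qed.

Lemma fcost_ge0 k a : 0 <= fcost k a.
Proof. by apply: sumr_ge0 => i _; rewrite mulr_ge0 ?sqr_ge0. Qed.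

Lemma fcostZXn k c i : (i <= k)%N -> fcost k (c *: 'X^i) = 0.
Proof.
move=> ik; rewrite (@fcost_widen _ i.+1); last first.
  by rewrite (leq_trans (size_scale_leq _ _))// size_polyXn.
by apply: big1 => j _; rewrite ltnNge (leq_trans _ ik) ?mul0r// -ltnS.
Qed.

Let wide2 a b : exists N : nat, forall s t : R, (size (s *: a + t *: b)%R <= N)%N.
Proof.
exists (maxn (size a) (size b)) => s t; apply: leq_trans (size_polyD _ _) _.
rewrite geq_max (leq_trans (size_scale_leq _ _) (leq_maxl _ _))/=.
exact: leq_trans (size_scale_leq _ _) (leq_maxr _ _).
Qed.

Lemma fcost_cvx k a b t : 0 <= t <= 1 ->
  fcost k (t *: a + (1 - t) *: b) <= t * fcost k a + (1 - t) * fcost k b.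
Proof.
move=> /andP[t0 t1]; have [N hN] := wide2 a b.
have ha : (size a <= N)%N by have := hN 1 0; rewrite scale1r scale0r addr0.
have hb : (size b <= N)%N by have := hN 0 1; rewrite scale1r scale0r add0r.
rewrite (fcost_widen _ ha) (fcost_widen _ hb) (fcost_widen _ (hN _ _)).
rewrite !mulr_sumr -big_split/=; apply: ler_sum => i _.
rewrite coefD !coefZ ![_ * (_%:R * _)]mulrCA -mulrDr ler_wpM2l//.
have := mulr_ge0 (mulr_ge0 t0 (_ : 0 <= 1 - t)) (sqr_ge0 (a`_i - b`_i)).
by rewrite subr_ge0 => /(_ t1); set u := a`_i; set w := b`_i; lra.
Qed.

Lemma fcost_parallelogram k a b h :
  fcost k (a + h *: b) + fcost k (a - h *: b) = 2 * fcost k a + 2 * h ^+ 2 * fcost k b.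
Proof.
have [N hN] := wide2 a b.
have ha : (size a <= N)%N by have := hN 1 0; rewrite scale1r scale0r addr0.
have hb : (size b <= N)%N by have := hN 0 1; rewrite scale1r scale0r add0r.
have h1 := hN 1 h; have h2 := hN 1 (- h); rewrite scale1r ?scaleNr in h1 h2.
rewrite (fcost_widen _ ha) (fcost_widen _ hb) (fcost_widen _ h1) (fcost_widen _ h2).
rewrite !mulr_sumr -!big_split/=; apply: eq_bigr => i _.
by rewrite coefB coefD !coefZ; ring.
Qed.

(* Distance to the span of the first [k + 1] generators, regularised by an
   inf-convolution with a quadratic cost on the other generators. *)
Definition sdist k x : R := infr setT (fun a => p (x - fcomb a) + fcost k a).

Let lb k x a : 0 <= p (x - fcomb a) + fcost k a.
Proof. by rewrite addr_ge0 ?fcost_ge0. Qed.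

Lemma sdist_le k x a : sdist k x <= p (x - fcomb a) + fcost k a.
Proof. by apply: (infr_le (c := 0)) => // j _; exact: lb. Qed.

Lemma sdist_ge k x c : (forall a, c <= p (x - fcomb a) + fcost k a) -> c <= sdist k x.
Proof. by move=> h; apply: (@le_infr _ _ _ _ _ 0). Qed.

Lemma sdist_near k x c : 0 < c -> exists a, p (x - fcomb a) + fcost k a <= sdist k x + c.
Proof.
move=> c0; have : sdist k x < sdist k x + c by rewrite ltrDl.
by move=> /(infr_lt (I : setT (0 : {poly R})))[a _ /ltW]; exists a.
Qed.

Lemma sdist_ge0 k x : 0 <= sdist k x.
Proof. by apply: sdist_ge => a; exact: lb. Qed.

Lemma sdist_gen k x i c : (i <= k)%N -> sdist k x <= p (x - c *: e i).
Proof.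
by move=> ik; have := sdist_le k x (c *: 'X^i); rewrite fcostZXn// addr0 fcombZ fcombXn.
Qed.

Lemma sdist_lep k x : sdist k x <= p x.
Proof. by have := @sdist_gen k x 0%N 0 (leq0n _); rewrite scale0r subr0. Qed.

Lemma sdist0 k : sdist k 0 = 0.
Proof. by apply/le_anti; rewrite sdist_ge0 andbT -p0 sdist_lep. Qed.

Lemma sdistD k x y : sdist k (x + y) <= sdist k x + p y.
Proof.
rewrite -lerBlDr; apply: sdist_ge => a; rewrite lerBlDr.
apply: (le_trans (sdist_le _ _ a)); rewrite [leRHS]addrAC lerD2r.
by rewrite [x + y - _]addrAC; exact: fnormD.
Qed.

Lemma sdist_cvx k : cvx (sdist k).
Proof.
move=> x y t t01; apply/ler_addgt0Pr => c c0.
have [a ha] := sdist_near k x c0; have [b hb] := sdist_near k y c0.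
apply: (le_trans (sdist_le _ _ (t *: a + (1 - t) *: b))).
rewrite fcombD !fcombZ.
have := fcost_cvx k a b t01; have /andP[t0 t1] := t01.
have -> : t *: x + (1 - t) *: y - (t *: fcomb a + (1 - t) *: fcomb b) =
  t *: (x - fcomb a) + (1 - t) *: (y - fcomb b) by rewrite opprD addrACA -!scalerBr.
have := fnormD F (t *: (x - fcomb a)) ((1 - t) *: (y - fcomb b)).
rewrite !fnormZ (ger0_norm t0) ger0_norm ?subr_ge0// -/p => h1 h2.
apply: (le_trans (lerD h1 h2)); nra.
Qed.

Lemma sdistN k x : sdist k (- x) = sdist k x.
Proof.
have h y : sdist k (- y) <= sdist k y.
  apply: sdist_ge => a; apply: (le_trans (sdist_le _ _ ((-1) *: a))).
  rewrite fcombZ scaleN1r opprK -pN opprD opprK lerD2l.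
  rewrite (fcost_widen _ (size_scale_leq _ _)); apply: ler_sum => i _.
  by rewrite coefZ mulN1r sqrrN.
by apply/le_anti; rewrite h/= -{1}[x]opprK h.
Qed.

(** Changing the coefficient of generator [0] costs nothing, since the weight [(k < i)%:R] vanishes
    at [i = 0]. *)
Lemma sdist_invariant k x t : sdist k (x + t *: e 0%N) = sdist k x.
Proof.
have h y u : sdist k (y + u *: e 0%N) <= sdist k y.
  apply: sdist_ge => a; apply: (le_trans (sdist_le _ _ (a + u *: 'X^0))).
  rewrite fcombD fcombZ fcombXn opprD addrACA subrr addr0 lerD2l.
  have [N hN] := wide2 a 'X^0.
  have ha : (size a <= N)%N by have := hN 1 0; rewrite scale1r scale0r addr0.
  have hb := hN 1 u; rewrite scale1r in hb.
  rewrite (fcost_widen _ ha) (fcost_widen _ hb); apply: ler_sum => i _.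
  by rewrite coefD coefZ coefXn; case: (nat_of_ord i) => [|j]; rewrite ?mul0r// mulr0 addr0.
by apply/le_anti; rewrite h/= -{1}(addrK (t *: e 0%N) x) -scaleNr h.
Qed.

(** A near-minimiser [a] for [x] is shifted by [h *: b] and [- h *: b] together with the point. The
    norm term is unchanged, and only the parallelogram identity for the cost remains. *)
Lemma sdist_second_diff k x b h :
  sdist k (x + h *: fcomb b) + sdist k (x - h *: fcomb b) - 2 * sdist k x
    <= 2 * h ^+ 2 * fcost k b.
Proof.
apply/ler_addgt0Pr => c c0; have c2 : 0 < c / 2 by rewrite divr_gt0.
have [a ha] := sdist_near k x c2.
have h1 := sdist_le k (x + h *: fcomb b) (a + h *: b).
have h2 := sdist_le k (x - h *: fcomb b) (a - h *: b).
have h3 := fcost_parallelogram k a b h.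
rewrite fcombD fcombZ opprD addrACA subrr addr0 in h1.
rewrite -[in fcomb (a - _)]scaleNr fcombD fcombZ scaleNr opprD addrACA subrr addr0 in h2.
move: (sdist k (x + _)) (sdist k (x - _)) (sdist k x) (p _) h1 h2 ha => s1 s2 s3 q h1 h2 ha.
move: (fcost k (a + _)) (fcost k (a - _)) (fcost k a) (fcost k b) h1 h2 h3 ha.
move=> k1 k2 k3 k4 h1 h2 h3 ha.
by nra.
Qed.

(** The previous bound covers the dense directions [fcomb b]; the error in approximating [v] enters
    through [sdistD]. Each contributes at most [c * h / 2]. *)
Lemma sdist_smooth k : gsmooth (sdist k).
Proof.
move=> x v c c0; have c4 : 0 < c / 4 by rewrite divr_gt0.
have [i [t hi]] := fgen_dense F v c4.
pose b : {poly R} := t *: 'X^i.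
have vb : p (v - fcomb b) < c / 4 by rewrite fcombZ fcombXn.
have K0 : 0 < 4 * (fcost k b + 1) by rewrite mulr_gt0// ltr_wpDl ?fcost_ge0.
exists (c / (4 * (fcost k b + 1))) => [|h /andP[h0]]; first exact: divr_gt0.
rewrite ltr_pdivlMr// => hc.
have := sdist_second_diff k x b h.
have := sdistD k (x + h *: fcomb b) (h *: (v - fcomb b)).
have := sdistD k (x - h *: fcomb b) (- (h *: (v - fcomb b))).
rewrite pN /p fnormZ -/p (gtr0_norm h0) -addrA -opprD -addrA -!scalerDr subrKC.
have := fcost_ge0 k b; nra.
Qed.

Let p_sum n (f : 'I_n -> X) (P : pred 'I_n) : p (\sum_(i | P i) f i) <= \sum_(i | P i) p (f i).
Proof.
elim/big_ind2 : _ => // [|x r y s hx hy]; first by rewrite p0.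
by apply: le_trans (fnormD _ _ _) _; exact: lerD.
Qed.

(** Dropping the coefficients [a_i] past [N] is nearly free: with [w = 2^-i],
    [|a_i| * w <= a_i^2 + w / 2], where [a_i^2] is already paid by the cost and the terms [w / 2]
    sum to at most [2^-N]. *)
Lemma sdist_lower k N x r : (k <= N)%N ->
  (forall s, spn [seq e i | i <- iota 0 N.+1] s -> r <= p (x - s)) ->
  r - (2 ^+ N)^-1 <= sdist k x.
Proof.
move=> kN h; apply: sdist_ge => a; rewrite lerBlDr.
pose s := \sum_(i < size a | (i <= N)%N) a`_i *: e i.
pose t := \sum_(i < size a | ~~ (i <= N)%N) a`_i *: e i.
have st : fcomb a = s + t by rewrite /fcomb (bigID (fun i : 'I__ => (i <= N)%N)).
apply: (le_trans (h s _)).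
  apply: spn_sum => i iN; apply/spnZ/spn_mem/mapP; exists (i : nat) => //.
  by rewrite mem_iota.
have -> : x - s = (x - fcomb a) + t by rewrite st opprD addrA subrK.
apply: (le_trans (fnormD _ _ _)); rewrite -addrA lerD2l.
apply: (le_trans (p_sum _ _)).
have := weights_tail R N (size a); rewrite big_mkord => hw.
apply: le_trans (lerD (lexx _) hw); rewrite -big_split/= big_mkcond.
apply: ler_sum => i _; rewrite /p fnormZ -/p -ltnNge.
have [Ni|iN] := ltnP N i; last first.
  apply: addr_ge0; first exact: mulr_ge0 (ler0n _ _) (sqr_ge0 _).
  exact: divr_ge0 (ler0n _ _) (exprn_ge0 _ (ler0n _ _)).
rewrite (leq_ltn_trans kN Ni) (ltnW Ni) !mul1r -[_ ^+ 2]real_normK ?num_real//.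
have ei : p (e i) <= (2 ^+ i)^-1 by apply: fgen_le; exact: leq_ltn_trans Ni.
rewrite [2 ^+ i.+1]exprS invfM; have w0 := w_gt0 R i; set w := (2 ^+ i)^-1 in ei w0 *.
have w1 : w <= 1 by rewrite invf_le1 ?exprn_gt0// exprn_ege1// ler1n.
have := sqr_ge0 (`|a`_i| - w / 2); have := normr_ge0 a`_i; have := p_ge0 (e i).
nra.
Qed.

Lemma sdist_lt k x r : sdist k x < r ->
  exists2 s, spn [seq e i | i <- iota 0 k.+1] s & p (x - s) < r + (2 ^+ k)^-1.
Proof.
move=> hr; apply: contrapT => /forall2NP H.
suff : r <= sdist k x by rewrite leNgt hr.
rewrite -[r](addrK (2 ^+ k)^-1); apply: (sdist_lower (leqnn k)) => s hs.
by have [//|/negP] := H s; rewrite -leNgt.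
Qed.

Lemma sdist_far k n t : (k <= n)%N -> 0 <= t ->
  t - (2 ^+ n)^-1 <= sdist k (t *: ffar F n) <= t.
Proof.
move=> kn t0; rewrite (sdist_lower kn) => [|s hs]; last exact: ffar_ge.
apply: (le_trans (sdist_lep _ _)); rewrite /p fnormZ ger0_norm// ler_piMr//.
exact: ffar_le.
Qed.

End SmoothedDistance.

(** * The potential *)

Section Potential.
Variables (R : realType) (X : normedModType R) (F : frame X).
Let e0 := fgen F 0%N.
Let f0 := fcoord0 F.
Let f0l : is_lin f0 := fcoord0_lin F.
Implicit Types (x y v : X).

(* The factor 40 keeps these coordinates in [-1/2, 1/2], where [huber] is the
   square, on the set where [potential] is at most 1. *)
Definition fcen j x : R := (fcoord F j x - fcoord F j e0 * f0 x) / 40.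

Lemma fcen_lin j : is_lin (fcen j).
Proof. by move=> a x y; rewrite /fcen (fcoord_lin F) f0l; ring. Qed.

Lemma fcen_gen0 j : fcen j e0 = 0.
Proof. by rewrite /fcen /f0 fcoord0_gen mulr1 subrr mul0r. Qed.

Lemma fcen_le j x : `|fcen j x| <= `|x| / 20.
Proof.
rewrite normrM normfV (ger0_norm (ler0n R 40)) ler_pdivrMr//.
apply: (le_trans (ler_normB _ _)); rewrite normrM.
have := fcoord_le F j x; have := fcoord_le F j e0; have := fcoord0_le F x.
rewrite /e0 fgen0 -/f0 -/e0; have := normr_ge0 (f0 x); have := normr_ge0 (fcoord F j e0).
nra.
Qed.

Definition fpiece k x : R := sdist F k x + huber (fcen k x).
Definition fseries x : R := wsum (fun k => fpiece k x).
Definition potential x : R := huber (f0 x) + fseries x.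

Lemma huber_cvx (f : X -> R) : is_lin f -> cvx (fun x => huber (f x)).
Proof.
move=> lf x y t /andP[t0 t1] /=; rewrite lf is_linZ//; set c := _ + _.
have := huber_ge (f x) c; have := huber_ge (f y) c.
have e1 : t * (f x - c) + (1 - t) * (f y - c) = 0 by rewrite /c; ring.
set h := huber c; set m := dhuber c => h1 h2.
have : t * (h + m * (f x - c)) + (1 - t) * (h + m * (f y - c)) = h.
  rewrite -[RHS]addr0 -[X in _ = _ + X](mulr0 m) -e1; ring.
nra.
Qed.

Lemma huber_gsmooth (f : X -> R) : is_lin f -> gsmooth (fun x => huber (f x)).
Proof.
move=> lf x v c c0; have k0 : 0 < 2 * f v ^+ 2 + 1 by rewrite ltr_wpDl// mulr_ge0// sqr_ge0.
exists (c / (2 * f v ^+ 2 + 1)) => [|h /andP[h0]]; first exact: divr_gt0.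
rewrite ltr_pdivlMr//= (is_linD _ _ lf) (is_linB _ _ lf) (is_linZ _ _ lf) => hc.
have := huber_le (f x + h * f v) (f x); have := huber_le (f x - h * f v) (f x).
have -> : f x + h * f v - f x = h * f v by ring.
have -> : f x - h * f v - f x = - (h * f v) by ring.
nra.
Qed.

Lemma gsmoothD (phi psi : X -> R) : gsmooth phi -> gsmooth psi ->
  gsmooth (fun x => phi x + psi x).
Proof.
move=> h1 h2 x v c c0; have c2 : 0 < c / 2 by rewrite divr_gt0.
have [d1 d10 hd1] := h1 x v _ c2; have [d2 d20 hd2] := h2 x v _ c2.
exists (Num.min d1 d2) => [|h /andP[h0]]; first by rewrite lt_min d10.
rewrite lt_min => /andP[k1 k2]; have := hd1 h; have := hd2 h.
by rewrite h0 k1 k2 => /(_ isT) + /(_ isT); lra.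
Qed.

Lemma fpiece_cvx k : cvx (fpiece k).
Proof.
move=> x y t t01; have := sdist_cvx F k x y t01; have := huber_cvx (fcen_lin k) x y t01.
by rewrite /fpiece /=; lra.
Qed.

Lemma fpiece_smooth k : gsmooth (fpiece k).
Proof. by apply: gsmoothD; [exact: sdist_smooth|exact: (huber_gsmooth (fcen_lin k))]. Qed.

Lemma fpieceN k x : fpiece k (- x) = fpiece k x.
Proof. by rewrite /fpiece sdistN (is_linN _ (fcen_lin k)) huberN. Qed.

Lemma fpiece0 k : fpiece k 0 = 0.
Proof. by rewrite /fpiece sdist0 (is_lin0 (fcen_lin k)) huber0 addr0. Qed.

Lemma fpiece_ge0 k x : 0 <= fpiece k x.
Proof. by rewrite addr_ge0 ?sdist_ge0 ?huber_ge0. Qed.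

Lemma fpiece_lip k x y : `|fpiece k x - fpiece k y| <= 4 * `|x - y|.
Proof.
have G a b : sdist F k a - sdist F k b <= 3 * `|a - b|.
  by have := sdistD F k b (a - b); rewrite subrKC; have := fnorm_le F (a - b); lra.
have hG : `|sdist F k x - sdist F k y| <= 3 * `|x - y|.
  by rewrite ler_norml G andbT; have := G y x; rewrite distrC; lra.
have := huber_lip (fcen k x) (fcen k y).
rewrite -(is_linB _ _ (fcen_lin k)); have := fcen_le k (x - y).
rewrite /fpiece opprD addrACA => h1 h2; apply: (le_trans (ler_normD _ _)).
by have := normr_ge0 (x - y); lra.
Qed.

Lemma fpiece_bnd x : ubnd (4 * `|x|) (fun k => fpiece k x).
Proof. by move=> k; have := fpiece_lip k x 0; rewrite fpiece0 !subr0. Qed.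

Lemma fpiece_invariant k x t : fpiece k (x + t *: e0) = fpiece k x.
Proof.
rewrite /fpiece sdist_invariant (is_linD _ _ (fcen_lin k)) (is_linZ _ _ (fcen_lin k)).
by rewrite fcen_gen0 mulr0 addr0.
Qed.

(** The series does not see [e0], so the Huber term of [f0] alone governs that direction. *)
Lemma fseries_invariant x t : fseries (x + t *: e0) = fseries x.
Proof. by congr wsum; apply/funext => k; exact: fpiece_invariant. Qed.

Lemma fseries0 : fseries 0 = 0.
Proof.
by rewrite -[RHS](wsum_cst 0); congr wsum; apply/funext => k; exact: fpiece0.
Qed.

Lemma fseries_lip x y : `|fseries x - fseries y| <= 4 * `|x - y|.
Proof.
rewrite /fseries -(wsumB (fpiece_bnd x) (fpiece_bnd y)); apply: wsum_norm => k.
exact: fpiece_lip.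
Qed.

Lemma fseries_cvx : cvx fseries.
Proof.
move=> x y t t01; rewrite /fseries -(wsumZ t (fpiece_bnd x)) -(wsumZ (1 - t) (fpiece_bnd y)).
have h1 := ubndZ t (fpiece_bnd x); have h2 := ubndZ (1 - t) (fpiece_bnd y).
rewrite -(wsumD h1 h2); apply: (wsum_le (fpiece_bnd _) (ubndD h1 h2)) => i.
exact: fpiece_cvx.
Qed.

(** The second difference quotients of the pieces are bounded by [8 * |v|] uniformly in [k] and [h],
    so [wsum_small] leaves finitely many pieces, each smooth. *)
Lemma fseries_smooth : gsmooth fseries.
Proof.
move=> x v c c0.
have [n [d [d0 hd]]] := wsum_small (8 * `|v|) c0.
have [r r0 hr] : exists2 r, 0 < r & forall h, 0 < h < r -> forall k, (k < n)%N ->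
    fpiece k (x + h *: v) + fpiece k (x - h *: v) - 2 * fpiece k x <= d * h.
  elim: n {hd} => [|n [r r0 hr]]; first by exists 1.
  have [s s0 hs] := @fpiece_smooth n x v d d0.
  exists (Num.min r s) => [|h /andP[h0]]; first by rewrite lt_min r0.
  rewrite lt_min => /andP[h1 h2] k; rewrite ltnS leq_eqVlt => /predU1P[->|].
    by apply: hs; rewrite h0.
  by apply: hr; rewrite h0.
exists r => // h hh; have /andP[h0 _] := hh.
pose u k := (fpiece k (x + h *: v) + fpiece k (x - h *: v) - 2 * fpiece k x) / h.
have u_ge0 k : 0 <= u k.
  rewrite divr_ge0 ?(ltW h0)//.
  have := @cvx_comb _ _ (fpiece k) 1 1 (x + h *: v) (x - h *: v) (@fpiece_cvx k)
    ler01 ler01 (addr_gt0 ltr01 ltr01).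
  have -> : (1 + 1)^-1 *: (1 *: (x + h *: v) + 1 *: (x - h *: v)) = x.
    by rewrite !scale1r addrACA subrr addr0 -mulr2n -scaler_nat scalerA mulVf// scale1r.
  lra.
have ub : ubnd (8 * `|v|) u.
  move=> k; rewrite ger0_norm// ler_pdivrMr//.
  have := fpiece_lip k (x + h *: v) x; have := fpiece_lip k (x - h *: v) x.
  have -> : x + h *: v - x = h *: v by rewrite addrC addKr.
  have -> : x - h *: v - x = - (h *: v) by rewrite addrC addKr.
  rewrite normrN normrZ (gtr0_norm h0).
  have := ler_norm (fpiece k (x - h *: v) - fpiece k x).
  have := ler_norm (fpiece k (x + h *: v) - fpiece k x); lra.
have := hd u ub _.
have -> : fseries (x + h *: v) + fseries (x - h *: v) - 2 * fseries x = h * wsum u.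
  have b1 := fpiece_bnd (x + h *: v); have b2 := fpiece_bnd (x - h *: v).
  have b3 := ubndZ 2 (fpiece_bnd x).
  rewrite -(wsumZ _ ub) /fseries -(wsumD b1 b2) -(wsumZ _ (fpiece_bnd x)).
  rewrite -(wsumB (ubndD b1 b2) b3); congr wsum; apply/funext => k.
  by rewrite /u [h * _]mulrC divfK// gt_eqF.
move=> H; have {}H : `|wsum u| <= c.
  by apply: H => k kn; rewrite ger0_norm// ler_pdivrMr//; exact: hr.
by rewrite mulrC ler_pM2r// (le_trans _ H)// ler_norm.
Qed.

Lemma potential_cvx : cvx potential.
Proof.
move=> x y t t01; have := fseries_cvx x y t01; have := huber_cvx f0l x y t01.
by rewrite /potential /=; lra.
Qed.

Lemma potential_smooth : gsmooth potential.
Proof. exact: (gsmoothD (huber_gsmooth f0l) fseries_smooth). Qed.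

Lemma potentialN x : potential (- x) = potential x.
Proof.
rewrite /potential (is_linN _ f0l) huberN; congr (_ + wsum _).
by apply/funext => k; exact: fpieceN.
Qed.

Lemma potential0 : potential 0 = 0.
Proof. by rewrite /potential fseries0 (is_lin0 f0l) huber0 addr0. Qed.

Lemma potential_lip x y : `|potential x - potential y| <= 5 * `|x - y|.
Proof.
have := fseries_lip x y; have := huber_lip (f0 x) (f0 y).
rewrite -(is_linB _ _ f0l); have := fcoord0_le F (x - y); rewrite -/f0.
rewrite /potential opprD addrACA => h1 h2 h3.
by apply: (le_trans (ler_normD _ _)); lra.
Qed.

Lemma sdist_le_fseries k x : sdist F k x / 2 ^+ k.+1 <= fseries x.
Proof.
have := wsum_term k (fpiece_bnd x) (fun i => fpiece_ge0 i x).
apply: le_trans; rewrite ler_pM2r ?w_gt0// lerDl; exact: huber_ge0.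
Qed.

(** The hypothesis gives [|f0 x| <= 5/4], and [sdist F 0 x <= 2] puts [x] within [4] of a multiple
    [t *: e0]. Hence [|t| <= 5/4 + 4] and [|x| <= 5/4 + 8]. *)
Lemma potential_bnd x : potential x <= 1 -> `|x| <= 10.
Proof.
move=> px; have h0 := huber_gt (f0 x); have h0' := huber_ge0 (f0 x).
have h1 := sdist_le_fseries 0 x; rewrite expr1 ler_pdivrMr// in h1.
have g1 : sdist F 0 x < 3 by rewrite /potential in px; lra.
have g2 := sdist_ge0 F 0 x.
have [s /= [t /eqP]] := sdist_lt g1; rewrite subr_eq0 => /eqP -> hs.
rewrite expr0 invr1 in hs.
have h2 := le_lt_trans (fnorm_ge F _) hs.
have h3 := fcoord0_le F (x - t *: fgen F 0%N).
rewrite -/f0 (is_linB _ _ f0l) (is_linZ _ _ f0l) {2}/f0 fcoord0_gen mulr1 in h3.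
have h4 := ler_normB (f0 x) (f0 x - t); rewrite opprB subrKC in h4.
have h5 := ler_normD (x - t *: fgen F 0%N) (t *: fgen F 0%N).
rewrite subrK normrZ fgen0 mulr1 in h5.
rewrite /potential in px; lra.
Qed.

(** For [k < n] the Huber term vanishes and [sdist_far] gives [t] up to [2^-n]; the other terms
    deviate from [t] by at most [5], with total weight [2^-n]. *)
Lemma fseries_far n t : 0 <= t <= 1 -> `|fseries (t *: ffar F n) - t| <= 6 / 2 ^+ n.
Proof.
move=> /andP[t0 t1].
have bt := ubnd_cst t.
have yn : `|t *: ffar F n| <= 1.
  rewrite normrZ ger0_norm// mulr_ile1//.
  exact: le_trans (fnorm_ge F _) (ffar_le F n).
rewrite /fseries -{2}(wsum_cst t) -(wsumB (fpiece_bnd _) bt).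
have ub : ubnd 5 (fun i => fpiece i (t *: ffar F n) - t).
  move=> i; apply: (le_trans (ler_normB _ _)).
  by have := fpiece_bnd (t *: ffar F n) i; rewrite /= (ger0_norm t0); lra.
apply: (le_trans (wsum_head (n := n) (d := (2 ^+ n)^-1) ub _ _)).
- by rewrite invr_ge0 exprn_ge0.
- move=> k kn; rewrite /fpiece.
  have -> : fcen k (t *: ffar F n) = 0.
    rewrite (is_linZ _ _ (fcen_lin k)) /fcen /f0 ffar0 ffar_coord//.
    by rewrite mulr0 subrr mul0r mulr0.
  rewrite huber0 addr0 ler_norml.
  have /andP[h1 h2] := sdist_far F (ltnW kn) t0.
  by have := w_gt0 R n; lra.
- by set w := (2 ^+ n)^-1; lra.
Qed.

End Potential.

(** * Denting points *)

Section PotentialDenting.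
Variables (R : realType) (X : normedModType R) (F : frame X).
Let e0 := fgen F 0%N.
Let f0 := fcoord0 F.
Let f0l : is_lin f0 := fcoord0_lin F.
Implicit Types (x y u v : X).

(** The constant [3] comes from [fnorm_le]; invariance along [e0], used with both signs, forces
    [l e0 = 0]. *)
Lemma sdist_subgradient k x : exists l, [/\ is_lin l,
  forall y, sdist F k x + l (y - x) <= sdist F k y,
  forall v, `|l v| <= 3 * `|v| & l e0 = 0].
Proof.
have [l [ll lx]] := subgradient x (sdist_cvx F k).
exists l; split=> // [y|v|].
- by have := lx (y - x); rewrite subrKC; lra.
- have lv w : l w <= 3 * `|w|.
    by have := lx w; have := sdistD F k x w; have := fnorm_le F w; lra.
  by rewrite ler_norml lv andbT; have := lv (- v); rewrite normrN (is_linN _ ll); lra.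
- have h t : t * l e0 <= 0.
    by have := lx (t *: e0); rewrite sdist_invariant subrr (is_linZ _ _ ll).
  by have := h 1; have := h (-1); lra.
Qed.

(* Scaling the subgradient of one piece by [1 - theta] makes [sdist F k] itself
   small on the slice, while the Bregman terms of all the other pieces stay
   controlled. *)
Lemma potential_functional x k (theta : R) : 0 <= theta <= 1 -> exists L : X -> R,
  [/\ is_lin L, forall v, `|L v| <= 4 * `|v|, L e0 = 0 & forall y,
    let gap := potential F y - potential F x - dhuber (f0 x) * f0 (y - x) - L (y - x) in
    [/\ - (theta * sdist F k x) <= gap,
      sdist F k x <= sdist F k y ->
        theta * (sdist F k y - sdist F k x) / 2 ^+ k.+1 <= gap
    & forall j, (huber (fcen F j y) - huber (fcen F j x)
        - dhuber (fcen F j x) * (fcen F j y - fcen F j x)) / 2 ^+ j.+1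
      <= gap + theta * sdist F k x]].
Proof.
move=> /andP[th0 th1].
have /choice[l hl] i := sdist_subgradient i x.
have ll i : is_lin (l i) by case: (hl i).
pose c i : R := if i == k then 1 - theta else 1.
have c01 i : 0 <= c i <= 1.
  by rewrite /c; case: eqP => _; rewrite ?ler01 ?lexx// subr_ge0 th1 gerBl.
pose g i v := c i * l i v + dhuber (fcen F i x) * fcen F i v.
have gb v : ubnd (4 * `|v|) (fun i => g i v).
  move=> i; apply: (le_trans (ler_normD _ _)).
  rewrite [`|c i * _|]normrM [`|dhuber _ * _|]normrM.
  have [_ _ hlv _] := hl i; have := hlv v; have := fcen_le F i v.
  have := dhuber_le1 (fcen F i x); have /andP[ci0 ci1] := c01 i.
  rewrite (ger0_norm ci0) => /(ler_wpM2r (normr_ge0 (fcen F i v))) h1.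
  have := ler_wpM2r (normr_ge0 (l i v)) ci1; rewrite !mul1r in h1 *.
  have := normr_ge0 v; lra.
exists (fun v => wsum (fun i => g i v)); split.
- move=> a u v; rewrite -(wsumZ a (gb u)) -(wsumD (ubndZ a (gb u)) (gb v)).
  congr wsum; apply/funext => i; rewrite /g (ll i) (fcen_lin F i); ring.
- by move=> v; exact: wsum_norm (gb v).
- rewrite -[RHS](wsum_cst 0); congr wsum; apply/funext => i.
  by rewrite /g (fcen_gen0 F); have [_ _ _ ->] := hl i; rewrite !mulr0 addr0.
move=> y gap.
pose br i := huber (fcen F i y) - huber (fcen F i x)
   - dhuber (fcen F i x) * (fcen F i y - fcen F i x).
pose T i := (fpiece F i y - fpiece F i x) - g i (y - x).
have fb := ubndD (fpiece_bnd F y) (ubndZ (-1) (fpiece_bnd F x)).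
have bT : ubnd (8 * `|y - x|) T.
  move=> i; apply: (le_trans (ler_normB _ _)).
  have := fpiece_lip F i y x; have := gb (y - x) i; rewrite /=; lra.
have br0 i : 0 <= br i by have := huber_ge (fcen F i y) (fcen F i x); rewrite /br; lra.
have TE i : T i = (sdist F i y - sdist F i x - c i * l i (y - x)) + br i.
  by rewrite /T /br /fpiece /g (is_linB _ _ (fcen_lin F i)); ring.
have Tne i : i != k -> br i <= T i.
  move=> /negbTE ik; rewrite TE /c ik mul1r lerDr.
  by have [_ h _ _] := hl i; have := h y; lra.
have Tk : theta * (sdist F k y - sdist F k x) + br k <= T k.
  rewrite TE /c eqxx lerD2r; have [_ h _ _] := hl k; have := h y; nra.
have sx := sdist_ge0 F k x; have sy := sdist_ge0 F k y.
(* Only the term [k] can be negative, and by at most [theta * sdist F k x]. *)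
have Tlow i : br i - theta * sdist F k x <= T i.
  have [->|/Tne] := eqVneq i k; last by have := mulr_ge0 th0 sx; lra.
  by have := mulr_ge0 th0 sy; lra.
have wT : wsum T <= gap.
  have -> : wsum T = fseries F y - fseries F x - wsum (fun i => g i (y - x)).
    rewrite -(wsumB (fpiece_bnd F y) (fpiece_bnd F x)).
    by rewrite -(wsumB (K := 4 * `|y - x|) (fun i => fpiece_lip F i y x) (gb (y - x))).
  have := huber_ge (f0 y) (f0 x).
  by rewrite /gap /potential -/f0 (is_linB _ _ f0l); lra.
(* The weights have total mass [1], so adding a constant to every term adds it to the sum. The
   shifted terms are nonnegative, and [wsum_term] isolates each one. *)
pose S i := T i + theta * sdist F k x.
have bS := ubndD bT (ubnd_cst (theta * sdist F k x)).
have S0 i : 0 <= S i by have := Tlow i; have := br0 i; rewrite /S; lra.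
have wS : wsum S = wsum T + theta * sdist F k x.
  by rewrite (wsumD bT (ubnd_cst _)) wsum_cst.
split.
- by have := wsum_ge0 bS S0; rewrite -/S wS; lra.
- move=> sxy; apply: le_trans wT.
  have T0 i : 0 <= T i.
    have [->|/Tne] := eqVneq i k; last by have := br0 i; lra.
    have : 0 <= theta * (sdist F k y - sdist F k x) by rewrite mulr_ge0// subr_ge0.
    by have := br0 k; lra.
  apply: le_trans (wsum_term k bT T0); rewrite ler_pM2r ?w_gt0//.
  by have := br0 k; lra.
- move=> j; rewrite -lerBlDr; apply: le_trans wT; rewrite lerBlDr -wS.
  apply: le_trans (wsum_term j bS S0); rewrite ler_pM2r ?w_gt0//.
  by have := Tlow j; rewrite /br; lra.
Qed.

(** The parameters are chosen in the order [eta], [d], [k], [J], [m], [theta], [a]: [k] puts [x]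
    close to the span of the first generators, [J] norms that span, [theta] is small enough for the
    Bregman terms up to [J], and [a] is small compared with [theta / 2^(k+1)]. *)
Lemma potential_denting x (eps : R) : potential F x = 1 -> 0 < eps ->
  exists (L : X -> R) (a : R), [/\ is_lin L, forall v, `|L v| <= 5 * `|v|, L x != 0, 0 < a
    & forall y, potential F y <= 1 -> L x - a < L y -> `|y - x| < eps].
Proof.
move=> px eps0.
have [z z0 hz] := huber_exposed (f0 x) (divr_gt0 eps0 (ltr0n R 2)).
pose eta : R := Num.min 1 (Num.min (eps / 4) (z / 16)).
have [eta1 etae etaz eta0] : [/\ eta <= 1, eta <= eps / 4, eta <= z / 16 & 0 < eta].
  by rewrite /eta !ge_min !lt_min !lexx !orbT ltr01/= !divr_gt0.
(* The bound for [u] below is [5 * d + 2 * (d + 5 * d) = 17 * d]. *)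
pose d := eta / 17.
have d0 : 0 < d by rewrite /d; lra.
have d_le1 : d <= 1 by rewrite /d; lra.
have [i0 [c hc]] := fgen_dense F x d0.
have [K hK] : exists K, (2 ^+ K)^-1 <= d.
  have d1 : 0 <= d^-1 by rewrite invr_ge0 ltW.
  have [K hK] : exists K : nat, d^-1 <= K%:R.
    exists (Num.truncn d^-1).+1; apply: ltW.
    by have /andP[] := truncn_itv d1.
  exists K; rewrite invf_ple ?posrE ?exprn_gt0// (le_trans hK)//.
  by rewrite -natrX ler_nat ltnW// ltn_expl.
pose k := maxn i0 K.
have dk : (2 ^+ k)^-1 <= d.
  apply: le_trans hK; rewrite lef_pV2 ?posrE ?exprn_gt0//.
  by rewrite ler_weXn2l ?ler1n// leq_maxr.
have sk : sdist F k x <= d.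
  by apply: le_trans (ltW hc); apply: sdist_gen; rewrite leq_maxl.
have [J hJ] := fcoord_norming F k.
(* For [j <= J] the Bregman term will be at most [2^(J+1) * (a + theta * sdist F k x) <= 2^(J+1) *
   (m + m) = (d / 40)^2]. *)
pose m : R := (d / 40) ^+ 2 / 2 ^+ J.+1 / 2.
have m0 : 0 < m by rewrite !divr_gt0 ?exprn_gt0// divr_gt0.
pose theta : R := Num.min 2^-1 m.
have [th0 th2 thm] : [/\ 0 < theta, theta <= 2^-1 & theta <= m].
  by rewrite /theta !ge_min !lt_min !lexx orbT m0 invr_gt0 ltr0n.
pose a : R := Num.min (z / 2) (Num.min m (d * theta / 2 ^+ k.+1)).
have [a0 az am ad] : [/\ 0 < a, a <= z / 2, a <= m & a <= d * theta / 2 ^+ k.+1].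
  by rewrite /a !ge_min !lt_min !lexx !orbT m0 !divr_gt0// ?mulr_gt0.
have [|L [Ll Lb Le hL]] := @potential_functional x k theta.
  by rewrite (ltW th0)/=; lra.
pose mu := dhuber (f0 x).
exists (fun v => mu * f0 v + L v), a; split=> //.
- by move=> s u v; rewrite f0l Ll; ring.
- move=> v; apply: (le_trans (ler_normD _ _)); rewrite normrM.
  have := ler_wpM2r (normr_ge0 (f0 v)) (dhuber_le1 (f0 x)).
  have := Lb v; have := fcoord0_le F v; rewrite -/f0 -/mu mul1r; lra.
(* At [y = 0] the gap is [mu * f0 x + L x - 1], and it is at least [- theta * sdist F k x >= - 1/2];
   so the functional is at least [1/2] at [x]. *)
- have [h _ _] := hL 0; rewrite sub0r potential0 px (is_linN _ f0l) (is_linN _ Ll) -/mu in h.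
  apply/eqP => e; have := ler_wpM2r (sdist_ge0 F k x) th2; lra.
move=> y py hy.
have [gap_lo gap_k gap_j] := hL y.
set gap := potential F y - _ - _ - _ in gap_lo gap_k gap_j.
have gap_a : gap <= a.
  by rewrite /gap px (is_linB _ _ f0l) (is_linB _ _ Ll) -/mu; lra.
have sky : sdist F k y < 3 * d.
  have [yx|xy] := leP (sdist F k y) (sdist F k x); first lra.
  have := le_trans (gap_k (ltW xy)) (le_trans gap_a ad).
  rewrite ler_pM2r ?w_gt0// [d * _]mulrC ler_pM2l//; lra.
have thd : theta * sdist F k x <= m.
  exact: le_trans (ler_piMr (ltW th0) (le_trans sk d_le1)) thm.
have d40 : 0 <= d / 40 by rewrite divr_ge0// ltW.
have cen j : (j <= J)%N -> `|fcen F j (y - x)| <= d / 40.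
  move=> jJ; have := le_trans (gap_j j) (lerD gap_a thd).
  rewrite huber_sq; first last.
  - by apply: (le_trans (fcen_le F j y)); have := potential_bnd py; lra.
  - apply: (le_trans (fcen_le F j x)); have := @potential_bnd _ _ F x.
    by rewrite px => /(_ (lexx _)); lra.
  rewrite -(is_linB _ _ (fcen_lin F j)) => h.
  rewrite -ler_sqr ?nnegrE// real_normK ?num_real//.
  have jJ2 : (2 ^+ j.+1 : R) <= 2 ^+ J.+1 by rewrite ler_weXn2l ?ler1n.
  rewrite ler_pdivrMr ?exprn_gt0// in h; apply: (le_trans h).
  have -> : (d / 40) ^+ 2 = (m + m) * 2 ^+ J.+1.
    by rewrite /m; field; rewrite expf_neq0.
  by apply: ler_pM; rewrite ?addr_ge0 ?exprn_ge0 ?(ltW m0) ?(ltW a0)// lerD.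
pose tau := f0 (y - x).
(* [u] is the part of [y - x] killed by [f0]; on it [fcoord F j] agrees with [40 * fcen F j]. *)
pose u := y - x - tau *: e0.
have fu j : fcoord F j u = 40 * fcen F j (y - x).
  rewrite /u (is_linB _ _ (fcoord_lin F j)) (is_linZ _ _ (fcoord_lin F j)).
  by rewrite /fcen -/f0 -/e0 -/tau; field.
have u_le : `|u| <= eta.
  have [s ls hs] := sdist_lt sky.
  have hs' := le_lt_trans (fnorm_ge F _) hs.
  have hc' := le_lt_trans (fnorm_ge F _) hc.
  (* [q] lies in the span of the first [k + 1] generators, where [hJ] applies, and is within [5 * d]
     of [u]. *)
  pose q := s - c *: fgen F i0 - tau *: e0.
  have [j jJ hj] : exists2 j, (j <= J)%N & `|q| <= 2 * `|fcoord F j q|.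
    apply: hJ; apply: spnB; [apply: spnB => //|];
    apply/spnZ/spn_mem/map_f; rewrite mem_iota// add0n ltnS leq_maxl//.
  have uq : `|u - q| <= 5 * d.
    have -> : u - q = (y - s) - (x - c *: fgen F i0).
      rewrite /u /q !opprD !opprK addrACA -addrA addNr addr0.
      by rewrite [RHS]addrACA.
    by apply: (le_trans (ler_normB _ _)); lra.
  have h1 := cen j jJ; have h2 := fu j.
  have h3 : `|fcoord F j u| <= d by rewrite h2 normrM ger0_norm//; lra.
  have h4 := le_trans (fcoord_le F j (u - q)) uq.
  rewrite (is_linB _ _ (fcoord_lin F j)) in h4.
  have h5 := ler_normB (fcoord F j u) (fcoord F j u - fcoord F j q).
  rewrite opprB subrKC in h5.
  have h6 := ler_normD (u - q) q; rewrite subrK in h6.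
  by rewrite /d in h3 h4 h5 uq *; lra.
have yE : y = x + u + tau *: e0 by rewrite /u addrA subrK subrKC.
have ser : `|fseries F y - fseries F x| <= 4 * eta.
  rewrite yE fseries_invariant; apply: (le_trans (fseries_lip _ _ _)).
  by rewrite [x + u]addrC addrK; lra.
have Lu : `|L (y - x)| <= 4 * eta.
  have -> : y - x = tau *: e0 + u by rewrite /u subrKC.
  by rewrite Ll Le mulr0 add0r; apply: (le_trans (Lb _)); lra.
have tauE : f0 y - f0 x = tau by rewrite /tau (is_linB _ _ f0l).
(* As the series ignores [e0], [huber (f0 y)] exceeds [huber (f0 x)] by at most [4 * eta]. The slice
   bounds [mu * tau] from below and convexity bounds it from above, so [huber_exposed] applies. *)
have tau_le : `|tau| <= eps / 2.
  have hh : huber (f0 y) <= huber (f0 x) + 4 * eta.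
    have := py; have := px; rewrite /potential -/f0.
    by move: ser; rewrite ler_norml => /andP[]; lra.
  rewrite -tauE; apply: hz; last lra.
  have := huber_ge (f0 y) (f0 x); rewrite -/mu => h7.
  move: Lu hy; rewrite (is_linB _ _ Ll) ler_norml => /andP[_ h8] h9.
  by rewrite ler_norml; apply/andP; split; rewrite mulrBr in h7 *; lra.
have -> : y - x = u + tau *: e0 by rewrite /u subrK.
apply: (le_lt_trans (ler_normD _ _)); rewrite normrZ /e0 fgen0 mulr1; lra.
Qed.

End PotentialDenting.

(** * Construction of the equivalent norm *)

Unset Implicit Arguments.

Theorem theorem1 (R : realType) (X : completeNormedModType R)
    (Xsep : separable_space X) (Xinf : infinite_dimensional X) :
  exists N : equiv_norm X,
    [/\ ALUR (renormed N), rotund (renormed N),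
        gateaux_smooth (renormed N) & ~ LUR (renormed N)].
Proof.
have [F] := frame_exists Xsep Xinf.
pose N : equiv_norm X := gauge_norm (ltr0n R 5) (ltr0n R 10) (potential_cvx F)
  (potentialN F) (potential0 F) (potential_lip F) (@potential_bnd _ _ F).
have N1 x : N x = 1 <-> potential F x = 1.
  exact: (gauge_eq1 (ltr0n R 5) (potential_cvx F) (potential0 F) (potential_lip F)).
have N_le1 x : N x <= 1 <-> potential F x <= 1.
  exact: (gauge_le1 (ltr0n R 5) (potential_cvx F) (potential0 F) (potential_lip F)).
have Ndist x : `|N x - 1| <= `|potential F x - 1|.
  exact: (gauge_dist1 (ltr0n R 5) (ltr0n R 10) (potential_cvx F)
    (potential0 F) (potential_lip F) (@potential_bnd _ _ F)).
have [m [M [m0 M0 mM]]] := enorm_equiv N.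
have alur : ALUR (renormed N).
  move=> x Nx; apply: renormed_denting => // e e0.
  have [L [a [Ll Lb Lx a0 hL]]] := potential_denting ((N1 x).1 Nx) (divr_gt0 e0 M0).
  exists L, a, (5 / m); split=> //.
    move=> y; apply: (le_trans (Lb y)); have /andP[h _] := mM y.
    by rewrite mulrAC -mulrA ler_pM2l// ler_pdivlMr// mulrC.
  move=> y /N_le1 py /(hL y py) h; have /andP[_ h'] := mM (y - x).
  by apply: (le_lt_trans h'); rewrite mulrC -ltr_pdivlMr.
exists N; split=> //.
- by move=> x Nx; apply: denting_extreme; exact: alur.
- apply: renormed_gateaux => x y e Nx e0.
  exact: (gauge_smooth (ltr0n R 5) (potential_cvx F) (potential0 F)
    (potential_lip F) (potential_smooth F) y Nx e0).
- pose e0 := fgen F 0%N.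
  (* For [s >= 1/2] the Huber term is affine, so the potential is close to [s + t - 1/4]. The point,
     the sequence and the midpoints below all have [s + t = 5/4], hence limit value [1]. *)
  have pE s t n : 0 <= t <= 1 -> 2^-1 <= s ->
      `|potential F (t *: ffar F n + s *: e0) - (s - 4^-1 + t)| <= 6 / 2 ^+ n.
    move=> t01 s2; rewrite /potential fseries_invariant.
    rewrite (is_linD _ _ (fcoord0_lin F)) !(is_linZ _ _ (fcoord0_lin F)).
    rewrite ffar0 fcoord0_gen mulr0 add0r mulr1 huberE//.
    by rewrite opprD addrACA subrr add0r; exact: fseries_far.
  apply: (@renormed_not_LUR _ _ N ((5 / 4) *: e0)
    (fun n => (1 / 4) *: ffar F n + 1 *: e0) (m / 4)).
  + apply/N1; rewrite -[_ *: e0]add0r /potential fseries_invariant fseries0.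
    rewrite add0r (is_linZ _ _ (fcoord0_lin F)) fcoord0_gen mulr1 huberE; lra.
  + by rewrite divr_gt0.
  (* [fcoord0 F] takes the value [- 1/4] on the difference and is bounded by the original norm,
     whence the separation [m / 4]. *)
  + move=> n; have /andP[h _] := mM ((1 / 4) *: ffar F n + 1 *: e0 - (5 / 4) *: e0).
    apply: le_trans h; rewrite ler_pM2l//.
    apply: le_trans (fcoord0_le F _).
    rewrite (is_linB _ _ (fcoord0_lin F)) (is_linD _ _ (fcoord0_lin F)).
    rewrite !(is_linZ _ _ (fcoord0_lin F)) ffar0 fcoord0_gen.
    by rewrite ler0_norm; lra.
  + move=> e ep; have [n0 hn0] : exists n0 : nat, 6 / e <= n0%:R.
      exists (Num.truncn (6 / e)).+1; apply: ltW.
      by have /andP[] := truncn_itv (ltW (divr_gt0 (ltr0n R 6) ep)).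
    have small n : (n0 <= n)%N -> 6 / 2 ^+ n <= e.
      move=> nn; rewrite ler_pdivrMr ?exprn_gt0// mulrC -ler_pdivrMr//.
      apply: (le_trans hn0); rewrite -natrX ler_nat.
      by apply: (leq_trans nn); rewrite ltnW// ltn_expl.
    exists n0 => n /small hn; split; apply: (le_trans (Ndist _)); apply: le_trans hn.
      have := @pE 1 (1 / 4) n; rewrite (_ : 1 - 4^-1 + 1 / 4 = 1); last by lra.
      by apply; lra.
    have -> : 2^-1 *: ((5 / 4) *: e0 + ((1 / 4) *: ffar F n + 1 *: e0)) =
      (1 / 8) *: ffar F n + (9 / 8) *: e0.
      rewrite addrCA -scalerDl scalerDr !scalerA.
      by congr (_ *: _ + _ *: _); field.
    have := @pE (9 / 8) (1 / 8) n; rewrite (_ : 9 / 8 - 4^-1 + 1 / 8 = 1); last by lra.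
    by apply; lra.
Qed.
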